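(* Assume there are constants $\gamma_t\ge 0$ ($t=0,\dots,T-1$) with $|C_t(x)-C_t(y)|\le\gamma_t|x-y|$ for all $x,y$. Then for every $t=0,1,\dots,T-1$ and every $x\in\mathbb R$: $H_t(x)-H^*_t(x)\le\omega_t(x)$ and $V_t(x)-V^*_t(x)\le\bar\omega_t(x)$.
   Context: Model. Fix an integer horizon $T\ge 2$, a discount factor $\alpha\in(0,1]$, and for $t=0,\dots,T-1$: unit ordering costs $c_t\in\mathbb R$, a salvage coefficient $c_T\in\mathbb R$, setup costs $K_t\ge 0$, functions $G_t:\mathbb R\to\mathbb R$, and independent nonnegative random demands $D_0,\dots,D_{T-1}$ with right-continuous distribution functions $F_t$ and finite means; all expectations appearing are assumed finite. Let $\delta(z)=1$ for $z>0$, $\delta(0)=0$. Put $C_t(y)=(c_t-\alpha c_{t+1})y+G_t(y)+\alpha c_{t+1}E[D_t]$. Standing assumptions: (i) each $C_t$ is convex with $C_t(y)\to+\infty$ as $|y|\to\infty$; (ii) $K_t\ge \alpha K_{t+1}$ for $t=0,\dots,T-2$. Let $V^*_T\equiv 0$, and for $t=T-1,\dots,0$: $H^*_t(y)=C_t(y)+\alpha E[V^*_{t+1}(y-D_t)]$ and $V^*_t(x)=\min_{y\ge x}\{K_t\delta(y-x)+H^*_t(y)\}$. Grid construction. Fix $\theta>0$, $z_m=m\theta$, $Z_\theta=\{z_m:m\in\mathbb Z\}$, $f_t(n)=F_t(z_{n+1})-F_t(z_n)$ ($n\ge -1$). $C^m_t=\min\{y: C_t(y)=\min_x C_t(x)\}$;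 with $z_{n_0}<C^m_t\le z_{n_0+1}$, $S^U_t=\min\{z_m\in Z_\theta: z_m\ge C^m_t,\ C_t(z_m)>C_t(z_{n_0})+K_t\}$. $s_{T-1}$ is a point with $s_{T-1}\le C^m_{T-1}$, $C_{T-1}(s_{T-1})=C_{T-1}(C^m_{T-1})+K_{T-1}$; $\bar I_{T-1}=s_{T-1}$. For $t=T-2,\dots,0$: $I_t=\max\{z_m\in Z_\theta: z_m<\min(\bar I_{t+1}-\theta,C^m_t)\}$, $\bar I_t=\max\{z_m\in Z_\theta: z_m\le I_t,\ C_t(z_m)>C_t(I_t)+K_t\}+\theta$. $H_{T-1}=C_{T-1}$, $S_{T-1}=C^m_{T-1}$; $V_t(y)=H_t(S_t)+K_t$ for $y<s_t$, $V_t(y)=H_t(y)$ for $y\ge s_t$. For $t=T-2,\dots,0$: $H_t(y)=C_t(y)+\alpha\sum_{n=-1}^\infty V_{t+1}(y-z_n)f_t(n)$; $S_t=\max\{z_m\in Z_\theta: I_t\le z_m\le S^U_t,\ H_t(z_m)=\min\{H_t(z_n):z_n\in Z_\theta, I_t\le z_n\le S^U_t\}\}$; $s_t=S_t$ if $K_t=0$, else $s_t=\min\{z_m\in Z_\theta:\bar I_t\le z_m\le S_t,\ H_t(z_m)\le H_t(S_t)+K_t\}$. Estimate functions. $\psi_{T-1}(x,y)=\bar\psi_{T-1}(x,y)=\gamma_{T-1}x$; $\varphi_{T-1}(x,y)=\bar\varphi_{T-1}(x,y)=0$ if $y<s_{T-1}$ and $=\gamma_{T-1}x$ if $y\ge s_{T-1}$.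 For $t=0,\dots,T-2$, with $n$ the integer such that $z_{n-1}\le y-s_{t+1}<z_n$: $\psi_t(x,y)=\gamma_tx$ if $y<s_{t+1}-\theta$, else $\psi_t(x,y)=\gamma_tx+\alpha\sum_{m=-1}^{n-1}\varphi_{t+1}(x,y-z_m)f_t(m)$; $\varphi_t(x,y)=0$ if $y<s_t$, $=\psi_t(y-s_t,y)$ if $y\ge s_t$ and $y-x<s_t$, $=\psi_t(x,y)$ if $y\ge s_t$ and $y-x\ge s_t$. Likewise $\bar\psi_t(x,y)=\gamma_tx$ if $y<s_{t+1}-\theta$, else $\bar\psi_t(x,y)=\gamma_tx+\alpha\sum_{m=-1}^{n-1}\bar\varphi_{t+1}(x,y-z_m)f_t(m)$; $\bar\varphi_t(x,y)=0$ if $y<s_t$, $=\bar\psi_t(y-s_t+\theta,y)$ if $y\ge s_t$ and $y-x<s_t$, $=\bar\psi_t(x,y)$ if $y\ge s_t$ and $y-x\ge s_t$. Error-bound functions. $\omega_{T-1}\equiv\bar\omega_{T-1}\equiv 0$, $\eta_{T-1}=0$. For $t=T-2,\dots,0$: $\omega_t(x)=\psi_t(\theta,x)-\gamma_t\theta+\alpha\sum_{n=-1}^\infty\bar\omega_{t+1}(x-z_n)f_t(n)$; $\eta_t=\bar\psi_t(\theta,S^U_t)+\omega_t(S^U_t)$; $\bar\omega_t(x)=\eta_t$ if $x\le S^U_t$ and $\bar\omega_t(x)=\max(\eta_t,\omega_t(x))$ if $x>S^U_t$. *)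

(* Defs.v *)
From HB Require Import structures.
From mathcomp Require Import all_boot all_order all_algebra.
From mathcomp Require Import all_classical all_reals all_analysis.
Import Order.TTheory GRing.Theory Num.Theory.
Local Open Scope ring_scope.
Local Open Scope classical_set_scope.

(* The inventory model.  The demand D_t is represented by its law      *)
(* mu t (a probability measure on the Borel sets of R); F_t is its     *)
(* distribution function.  Only the marginal laws enter the definitions*)
(* (independence plays no role in the formulas).                       *)
Record model (R : realType) := Model {
  T : nat;                        (* horizon *)
  alpha : R;                      (* discount factor *)
  cc : nat -> R;
  KK : nat -> R;                  (* setup costs *)
  GG : nat -> R -> R;
  mu : nat -> probability R R
}.
Arguments T {R}. Arguments alpha {R}. Arguments cc {R}. Arguments KK {R}.
Arguments GG {R}. Arguments mu {R}.

Definition Ex {R : realType} (M : model R) (t : nat) (g : R -> R) (y : R) : R :=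
  fine (\int[mu M t]_d (g (y - d))%:E)%E.

Definition mean {R : realType} (M : model R) (t : nat) : R :=
  fine (\int[mu M t]_d (d%:E))%E.

Definition Fd {R : realType} (M : model R) (t : nat) (x : R) : R :=
  fine (mu M t `]-oo, x]).

Definition Cf {R : realType} (M : model R) (t : nat) (y : R) : R :=
  (cc M t - alpha M * cc M t.+1) * y + GG M t y + alpha M * cc M t.+1 * mean M t.

Definition delta {R : realType} (z : R) : R := if 0 < z then 1 else 0.

(* VstarK k = V^*_{T-k}; the minimum over y >= x is rendered as an infimum *)
Fixpoint VstarK {R : realType} (M : model R) (k : nat) : R -> R :=
  match k with
  | 0 => fun _ => 0
  | k'.+1 => fun x =>
      let t := (T M - k'.+1)%N in
      inf [set KK M t * delta (y - x) + (Cf M t y + alpha M * Ex M t (VstarK M k') y)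
          | y in `[x, +oo[ ]
  end.

Definition Vstar {R : realType} (M : model R) (t : nat) : R -> R := VstarK M (T M - t).

Definition Hstar {R : realType} (M : model R) (t : nat) (y : R) : R :=
  Cf M t y + alpha M * Ex M t (Vstar M t.+1) y.

Definition convex_real {R : realType} (f : R -> R) : Prop :=
  forall x y l : R, 0 <= l <= 1 -> f (l * x + (1 - l) * y) <= l * f x + (1 - l) * f y.

Definition coercive {R : realType} (f : R -> R) : Prop :=
  forall A : R, exists r : R, forall y : R, r < `|y| -> A < f y.

(* Grid construction (theta > 0, sT = s_{T-1})                         *)
Definition zg {R : realType} (theta : R) (m : int) : R := m%:~R * theta.

Definition ongrid {R : realType} (theta : R) (z : R) : Prop := exists m : int, z = zg theta m.

Definition gmax {R : realType} (theta : R) (P : R -> Prop) : R :=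
  sup [set z | ongrid theta z /\ P z].
Definition gmin {R : realType} (theta : R) (P : R -> Prop) : R :=
  inf [set z | ongrid theta z /\ P z].

Definition fg {R : realType} (M : model R) (theta : R) (t : nat) (n : int) : R :=
  Fd M t (zg theta (n + 1)) - Fd M t (zg theta n).

Definition gsum {R : realType} (g : int -> R) : R :=
  limn (fun N : nat => \sum_(0 <= k < N) g (k%:Z - 1)).

Definition Cm {R : realType} (M : model R) (t : nat) : R :=
  inf [set y | Cf M t y = inf (range (Cf M t))].

Definition zn0 {R : realType} (M : model R) (theta : R) (t : nat) : R :=
  gmax theta (fun z => z < Cm M t).

Definition SU {R : realType} (M : model R) (theta : R) (t : nat) : R :=
  gmin theta (fun z => Cm M t <= z /\ Cf M t (zn0 M theta t) + KK M t < Cf M t z).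

Definition I_of {R : realType} (M : model R) (theta : R) (t : nat) (Ibn : R) : R :=
  gmax theta (fun z => z < Num.min (Ibn - theta) (Cm M t)).

Definition Ibar_step {R : realType} (M : model R) (theta : R) (t : nat) (Ibn : R) : R :=
  gmax theta (fun z => z <= I_of M theta t Ibn /\
                       Cf M t (I_of M theta t Ibn) + KK M t < Cf M t z) + theta.

(* IbarK k = \bar I_{T-1-k} *)
Fixpoint IbarK {R : realType} (M : model R) (theta sT : R) (k : nat) : R :=
  match k with
  | 0 => sT
  | k'.+1 => Ibar_step M theta (T M - 1 - k'.+1)%N (IbarK M theta sT k')
  end.

Definition Ibar {R : realType} (M : model R) (theta sT : R) (t : nat) : R :=
  IbarK M theta sT (T M - 1 - t).

Definition It {R : realType} (M : model R) (theta sT : R) (t : nat) : R :=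
  I_of M theta t (Ibar M theta sT t.+1).

Definition Vof {R : realType} (M : model R) (t : nat) (d : (R -> R) * R * R) (y : R) : R :=
  let: (H, S0, s0) := d in if y < s0 then H S0 + KK M t else H y.

(* lev k = (H_t, S_t, s_t) for t = T-1-k *)
Fixpoint lev {R : realType} (M : model R) (theta sT : R) (k : nat) : (R -> R) * R * R :=
  match k with
  | 0 => (Cf M (T M - 1)%N, Cm M (T M - 1)%N, sT)
  | k'.+1 =>
      let t := (T M - 1 - k'.+1)%N in
      let Vn := Vof M t.+1 (lev M theta sT k') in
      let H := fun y => Cf M t y + alpha M * gsum (fun n => Vn (y - zg theta n) * fg M theta t n) in
      let inrng := fun z => It M theta sT t <= z <= SU M theta t in
      let S := gmax theta (fun z => inrng z /\
                 forall z', ongrid theta z' -> inrng z' -> H z <= H z') in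
      let s := if KK M t == 0 then S
               else gmin theta (fun z => Ibar M theta sT t <= z <= S /\ H z <= H S + KK M t) in
      (H, S, s)
  end.

Definition Hg {R : realType} (M : model R) (theta sT : R) (t : nat) : R -> R :=
  (lev M theta sT (T M - 1 - t)).1.1.
Definition Sg {R : realType} (M : model R) (theta sT : R) (t : nat) : R :=
  (lev M theta sT (T M - 1 - t)).1.2.
Definition sg {R : realType} (M : model R) (theta sT : R) (t : nat) : R :=
  (lev M theta sT (T M - 1 - t)).2.
Definition Vg {R : realType} (M : model R) (theta sT : R) (t : nat) : R -> R :=
  Vof M t (lev M theta sT (T M - 1 - t)).

(* psi_t (t <= T-2) built from phi_{t+1}; the sum runs over m = -1, ..., n-1
   where z_{n-1} <= y - s_{t+1} < z_n, i.e. n - 1 = floor((y - s_{t+1})/theta). *)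
Definition psi_of {R : realType} (M : model R) (theta sT : R) (gamma : nat -> R)
    (t : nat) (phin : R -> R -> R) (x y : R) : R :=
  if y < sg M theta sT t.+1 - theta then gamma t * x
  else gamma t * x + alpha M *
    \sum_(0 <= k < absz (Num.floor ((y - sg M theta sT t.+1) / theta) + 2))
       phin x (y - zg theta (k%:Z - 1)) * fg M theta t (k%:Z - 1).

(* phiK k = phi_{T-1-k} *)
Fixpoint phiK {R : realType} (M : model R) (theta sT : R) (gamma : nat -> R) (k : nat)
    : R -> R -> R :=
  match k with
  | 0 => fun x y => if y < sT then 0 else gamma (T M - 1)%N * x
  | k'.+1 =>
      let t := (T M - 1 - k'.+1)%N in
      let st := sg M theta sT t in
      fun x y => if y < st then 0
                 else if y - x < st then psi_of M theta sT gamma t (phiK M theta sT gamma k') (y - st) y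
                 else psi_of M theta sT gamma t (phiK M theta sT gamma k') x y
  end.

Fixpoint phibarK {R : realType} (M : model R) (theta sT : R) (gamma : nat -> R) (k : nat)
    : R -> R -> R :=
  match k with
  | 0 => fun x y => if y < sT then 0 else gamma (T M - 1)%N * x
  | k'.+1 =>
      let t := (T M - 1 - k'.+1)%N in
      let st := sg M theta sT t in
      fun x y => if y < st then 0
                 else if y - x < st then psi_of M theta sT gamma t (phibarK M theta sT gamma k') (y - st + theta) y
                 else psi_of M theta sT gamma t (phibarK M theta sT gamma k') x y
  end.

Definition phi {R : realType} (M : model R) (theta sT : R) (gamma : nat -> R) (t : nat) :=
  phiK M theta sT gamma (T M - 1 - t).
Definition phibar {R : realType} (M : model R) (theta sT : R) (gamma : nat -> R) (t : nat) :=
  phibarK M theta sT gamma (T M - 1 - t).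

Definition psi {R : realType} (M : model R) (theta sT : R) (gamma : nat -> R) (t : nat)
    : R -> R -> R :=
  if (t.+1 < T M)%N then psi_of M theta sT gamma t (phi M theta sT gamma t.+1)
  else fun x _ => gamma t * x.
Definition psibar {R : realType} (M : model R) (theta sT : R) (gamma : nat -> R) (t : nat)
    : R -> R -> R :=
  if (t.+1 < T M)%N then psi_of M theta sT gamma t (phibar M theta sT gamma t.+1)
  else fun x _ => gamma t * x.

Definition om_of {R : realType} (M : model R) (theta sT : R) (gamma : nat -> R)
    (t : nat) (obn : R -> R) (x : R) : R :=
  psi M theta sT gamma t theta x - gamma t * theta
  + alpha M * gsum (fun n => obn (x - zg theta n) * fg M theta t n).

(* ombarK k = \bar omega_{T-1-k} *)
Fixpoint ombarK {R : realType} (M : model R) (theta sT : R) (gamma : nat -> R) (k : nat)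
    : R -> R :=
  match k with
  | 0 => fun _ => 0
  | k'.+1 =>
      let t := (T M - 1 - k'.+1)%N in
      let om := om_of M theta sT gamma t (ombarK M theta sT gamma k') in
      let eta := psibar M theta sT gamma t theta (SU M theta t) + om (SU M theta t) in
      fun x => if x <= SU M theta t then eta else Num.max eta (om x)
  end.

Definition ombar {R : realType} (M : model R) (theta sT : R) (gamma : nat -> R) (t : nat) :=
  ombarK M theta sT gamma (T M - 1 - t).

Definition omega {R : realType} (M : model R) (theta sT : R) (gamma : nat -> R) (t : nat)
    : R -> R :=
  if (t.+1 < T M)%N then om_of M theta sT gamma t (ombar M theta sT gamma t.+1)
  else fun _ => 0.

(* Main.v *)
(* Replacing the demand D, lying in a cell ]z_n, z_(n+1)], by z_n shifts the argument of
   V_(t+1) upwards by at most theta.  The functions phi and \bar phi bound the increase, resp.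
   the decrease, of V_t over such shifts, so H_t - H^*_t <= omega_t follows cell by cell from
   V_(t+1) - V^*_(t+1) <= \bar omega_(t+1).  To pass to V_t one bounds V_t(x) against the cost
   of every order-up-to level y >= x in the exact problem.  If x >= C^m_t, ordering cannot pay,
   since V^*_(t+1)(u) <= K_(t+1) + V^*_(t+1)(v) for u <= v.  If x < C^m_t, H_t(x) is compared
   with H_t at grid points: there H_t is K_t-convex (off the grid it need not be) and minimal
   at S_t, and the grid point just below y is compared directly with H^*_t(y), at the
   price of one term \bar psi_t(theta, S^U_t). *)
Require Import Defs.
From HB Require Import structures.
From mathcomp Require Import all_boot all_order all_algebra.
From mathcomp Require Import all_classical all_reals all_analysis.
From mathcomp Require Import lra ring zify.
Import Order.TTheory GRing.Theory Num.Theory.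
Import numFieldNormedType.Exports.
Local Open Scope ring_scope.
Local Open Scope classical_set_scope.

(** * Grid arithmetic, rounding, and extrema over grid points *)

Section Grid.
Variables (R : realType) (theta : R).
Implicit Types (a b x y z : R) (P : R -> Prop).

Lemma zgD (m n : int) : zg theta (m + n) = zg theta m + zg theta n.
Proof. by rewrite /zg intrD mulrDl. Qed.

Lemma zgN1 : zg theta (-1) = - theta.
Proof. by rewrite /zg mulrN1z mulN1r. Qed.

Lemma zgS (n : int) : zg theta (n + 1) = zg theta n + theta.
Proof. by rewrite zgD {2}/zg mul1r. Qed.

Lemma zg_pred_natS (k : nat) : zg theta (k.+1%:Z - 1) = zg theta (k%:Z - 1) + theta.
Proof. by rewrite -zgS; congr zg; lia. Qed.

Hypothesis theta0 : 0 < theta.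

Lemma zg_pred_nat_le (k m : nat) : (k <= m)%N -> zg theta (k%:Z - 1) <= zg theta (m%:Z - 1).
Proof. by move=> km; rewrite /zg ler_pM2r// ler_int; lia. Qed.

Lemma zg_ge (k : nat) : - theta <= zg theta (k%:Z - 1).
Proof. by rewrite -zgN1 -[X in zg _ X]/(0%:Z - 1); exact: zg_pred_nat_le. Qed.

Lemma ongrid_zg n : ongrid theta (zg theta n). Proof. by exists n. Qed.

Lemma ongridD a b : ongrid theta a -> ongrid theta b -> ongrid theta (a + b).
Proof. by move=> [m ->] [n ->]; exists (m + n); rewrite zgD. Qed.

Lemma ongridN a : ongrid theta a -> ongrid theta (- a).
Proof. by move=> [m ->]; exists (- m); rewrite /zg mulrNz mulNr. Qed.

Lemma ongridB a b : ongrid theta a -> ongrid theta b -> ongrid theta (a - b).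
Proof. by move=> ga gb; apply: ongridD => //; exact: ongridN. Qed.

Lemma ongrid_theta : ongrid theta theta.
Proof. by exists 1; rewrite /zg mul1r. Qed.

Lemma ongrid_gap a b : ongrid theta a -> ongrid theta b -> a < b -> a + theta <= b.
Proof.
move=> [m ->] [n ->]; rewrite /zg ltr_pM2r// ltr_int => mn.
by rewrite -{2}[theta]mul1r -mulrDl ler_pM2r// -(intrD _ m 1) ler_int; lia.
Qed.

Lemma ongrid_floor x : exists z, [/\ ongrid theta z, z <= x & x < z + theta].
Proof.
exists (zg theta (Num.floor (x / theta))); split; first exact: ongrid_zg.
  by rewrite /zg -ler_pdivlMr// floor_le_tmp.
by rewrite -zgS /zg -ltr_pdivrMr// floorD1_gt.
Qed.

Lemma ongrid_ceil x : exists z, [/\ ongrid theta z, z - theta < x & x <= z].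
Proof.
have [z [gz zx xz]] := ongrid_floor (- x).
by exists (- z); split; [exact: ongridN|lra|lra].
Qed.

(** The supremum is attained: some admissible grid point [e] lies within [theta] of it, and an
    admissible grid point above [e] would be at least [e + theta], beyond the supremum. *)
Lemma gmaxP P : (exists z, ongrid theta z /\ P z) ->
  (exists b, forall z, P z -> z <= b) ->
  [/\ ongrid theta (gmax theta P), P (gmax theta P) &
      forall z, ongrid theta z -> P z -> z <= gmax theta P].
Proof.
rewrite /gmax; set A := [set z | _] => A0 [b Ab].
have Asup : has_sup A by split=> //; exists b => z [_ /Ab].
have [e Ae le] := sup_adherent theta0 Asup.
have Aub z : A z -> z <= sup A by exact: ub_le_sup Asup.2 _.
suff -> : sup A = e.
  case: (Ae) => ge Pe; split=> // z gz Pz; rewrite leNgt; apply/negP => ez.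
  by have := Aub z (conj gz Pz); have := ongrid_gap _ _ ge gz ez; lra.
apply/eqP; rewrite eq_le Aub// andbT leNgt; apply/negP => esup.
have se0 : 0 < sup A - e by rewrite subr_gt0.
have [e' Ae'] := sup_adherent se0 Asup.
rewrite subKr => ee'; have := Aub e' Ae'.
by have := ongrid_gap _ _ (proj1 Ae) (proj1 Ae') ee'; lra.
Qed.

(** Reflection [z -> - z], which preserves the grid, reduces this to [gmaxP]. *)
Lemma gminP P : (exists z, ongrid theta z /\ P z) ->
  (exists b, forall z, P z -> b <= z) ->
  [/\ ongrid theta (gmin theta P), P (gmin theta P) &
      forall z, ongrid theta z -> P z -> gmin theta P <= z].
Proof.
move=> [z0 [gz0 Pz0]] [b Pb].
have [||gm Pm mm] := @gmaxP (fun z => P (- z)).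
- by exists (- z0); rewrite opprK; split=> //; exact: ongridN.
- by exists (- b) => z /Pb; lra.
have -> : gmin theta P = - gmax theta (fun z => P (- z)).
  rewrite /gmin /gmax /inf; congr (- sup _); apply/seteqP; split=> z /=.
    by move=> [w [gw Pw] <-]; rewrite opprK; split=> //; exact: ongridN.
  by move=> [gz Pz]; exists (- z); rewrite ?opprK//; split=> //; exact: ongridN.
split=> // [|z gz Pz]; first exact: ongridN.
have : - z <= gmax theta (fun z => P (- z)) by apply: mm; [exact: ongridN|rewrite opprK].
lra.
Qed.

End Grid.

(* The expectation of [a n] where [n] is the index of the cell ]z_n, z_(n+1)] of the demand. *)
Definition cell_expectation (R : realType) (M : model R) (theta : R) (t : nat) (a : int -> R) : R :=
  gsum (fun n => a n * fg M theta t n).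

(* Eventual constancy makes the limit defining [gsum] exist. *)
Definition eventually_constant (R : realType) (a : int -> R) :=
  exists N c, forall k : nat, (N <= k)%N -> a (k%:Z - 1) = c.

(** * Closure properties of eventually constant sequences *)

Section EventuallyConstant.
Variable R : realType.
Implicit Types a b : int -> R.

Lemma eventually_constant_cst (c : R) : eventually_constant R (fun=> c).
Proof. by exists 0%N, c. Qed.

Lemma eventually_constantD a b : eventually_constant R a -> eventually_constant R b ->
  eventually_constant R (fun n => a n + b n).
Proof.
move=> [N [c ac]] [N' [c' bc]]; exists (maxn N N'), (c + c') => k.
by rewrite geq_max => /andP[/ac -> /bc ->].
Qed.

Lemma eventually_constantZ (x : R) a : eventually_constant R a ->
  eventually_constant R (fun n => x * a n).
Proof. by move=> [N [c ac]]; exists N, (x * c) => k /ac ->. Qed.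

End EventuallyConstant.

Local Ltac evconst := repeat first [assumption | exact: eventually_constant_cst
  | apply: eventually_constantD | apply: eventually_constantZ].

(** * Distribution function, cell expectations, and their comparison with integrals *)

Section Expectation.
Variables (R : realType) (M : model R) (theta : R) (t : nat).
Hypothesis theta0 : 0 < theta.
Hypothesis demand_ge0 : mu M t `]-oo, 0[ = 0%E.
Implicit Types (a b : int -> R) (g : R -> R).
Let P := mu M t.

Local Notation cellE := (cell_expectation R M theta t).

Lemma FdE x : (Fd M t x)%:E = P `]-oo, x].
Proof. by rewrite /Fd fineK// fin_num_measure. Qed.

Lemma Fd_le1 x : Fd M t x <= 1.
Proof. by rewrite -lee_fin FdE; exact: probability_le1. Qed.

Lemma Fd_homo x y : x <= y -> Fd M t x <= Fd M t y.
Proof.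
move=> xy; rewrite -lee_fin !FdE; apply: le_measure; rewrite ?inE//.
by move=> z /=; rewrite !in_itv/= => /le_trans; apply.
Qed.

Lemma Fd_Ntheta : Fd M t (- theta) = 0.
Proof.
apply/EFin_inj; rewrite FdE; apply/eqP; rewrite -measure_le0 -demand_ge0.
apply: le_measure; rewrite ?inE// => z /=; rewrite !in_itv/= => zt.
by apply: le_lt_trans zt _; rewrite oppr_lt0.
Qed.

Lemma Fd_cell x y : x <= y -> fine (P `]x, y]) = Fd M t y - Fd M t x.
Proof.
move=> xy; apply/eqP; rewrite eq_sym subr_eq; apply/eqP/EFin_inj.
rewrite EFinD !FdE fineK ?fin_num_measure// -measureU//.
- rewrite setUC -itv_bndbnd_setU//.
- apply/seteqP; split=> z //= []; rewrite !in_itv/= => /andP[xz _] zx.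
  by move: xz; rewrite ltNge zx.
Qed.

Lemma Fd_tail x : fine (P `]x, +oo[) = 1 - Fd M t x.
Proof.
apply/eqP; rewrite eq_sym subr_eq; apply/eqP/EFin_inj.
rewrite EFinD !FdE fineK ?fin_num_measure// -measureU//.
- by rewrite setUC -itv_bndbnd_setU// set_itvNyy; exact/esym/(probability_setT P).
- apply/seteqP; split=> z //= []; rewrite !in_itv/= andbT => xz zx.
  by move: xz; rewrite ltNge zx.
Qed.

Lemma fg_ge0 n : 0 <= fg M theta t n.
Proof. by rewrite /fg subr_ge0 Fd_homo// zgS lerDl ltW. Qed.

(** The sum telescopes, and its lower end is [Fd] at [- theta], which is 0 because demand is
    nonnegative. *)
Lemma fg_sum (N : nat) :
  \sum_(0 <= k < N) fg M theta t (k%:Z - 1) = Fd M t (zg theta (N%:Z - 1)).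
Proof.
elim: N => [|N IH]; first by rewrite big_nil -[_ - 1]/(-1 : int) zgN1 Fd_Ntheta.
rewrite big_nat_recr//= IH /fg zgS zg_pred_natS. by rewrite addrC subrK.
Qed.

Lemma Fd_cvg1 : (fun N : nat => Fd M t (zg theta (N%:Z - 1))) @ \oo --> (1 : R).
Proof.
pose F (N : nat) : set R := `]-oo, zg theta (N%:Z - 1)]%classic.
have FT : \bigcup_N F N = setT.
  apply/seteqP; split=> x //= _.
  pose n := Num.truncn (`|x| / theta).
  exists n.+2 => //; rewrite /F/= in_itv/=.
  have -> : n.+2%:Z - 1 = n.+1%:Z by lia.
  rewrite /zg -ler_pdivrMr// -pmulrn ltW//; apply: le_lt_trans (truncnS_gt _).
  by rewrite ler_pM2r ?invr_gt0// ler_norm.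
have Fcvg : (P \o F) x @[x --> \oo] --> P (\bigcup_N F N).
  apply: nondecreasing_cvg_mu => [i||]; first exact: measurable_itv.
    by apply: bigcup_measurable => i _; exact: measurable_itv.
  move=> n m nm; apply/subsetPset => x; rewrite /F/= !in_itv/= => /le_trans; apply.
  exact: zg_pred_nat_le.
by move: Fcvg; rewrite FT (probability_setT P : P setT = 1%E) => /fine_cvg; exact.
Qed.

(** Beyond [N] the weights telescope, so the partial sums are a fixed finite sum plus [c] times an
    increment of [Fd], which tends to 1. The rules for cell expectations below rest on this finite
    expression. *)
Lemma cellEE a N c : (forall k : nat, (N <= k)%N -> a (k%:Z - 1) = c) ->
  cellE a = \sum_(0 <= k < N) a (k%:Z - 1) * fg M theta t (k%:Z - 1)
            + c * (1 - Fd M t (zg theta (N%:Z - 1))).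
Proof.
move=> ac; rewrite /cell_expectation /gsum; apply/cvg_lim => //.
set u := fun n : nat => _.
have uE n : (N <= n)%N -> u n = \sum_(0 <= k < N) a (k%:Z - 1) * fg M theta t (k%:Z - 1)
    + c * (Fd M t (zg theta (n%:Z - 1)) - Fd M t (zg theta (N%:Z - 1))).
  move=> Nn; rewrite /u (big_cat_nat (n := N))//=; congr (_ + _).
  rewrite -!fg_sum (big_cat_nat (m := 0%N) (n := N) (p := n))//= [X in c * X]addrAC subrr add0r mulr_sumr.
  by rewrite big_nat [RHS]big_nat; apply: eq_bigr => k /andP[Nk _]; rewrite ac.
apply: cvg_trans.
  apply: near_eq_cvg; near=> n; apply/esym/uE; near: n; exact: nbhs_infty_ge.
apply: cvgD; first exact: cvg_cst.
apply: cvgM; first exact: cvg_cst.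
apply: cvgB; [exact: Fd_cvg1|exact: cvg_cst].
Unshelve. all: by end_near. Qed.

Lemma cellED a b : eventually_constant R a -> eventually_constant R b ->
  cellE (fun n => a n + b n) = cellE a + cellE b.
Proof.
move=> [N [c ac]] [N' [c' bc]].
rewrite (@cellEE a (maxn N N') c); last by move=> k kN; apply: ac; lia.
rewrite (@cellEE b (maxn N N') c'); last by move=> k kN; apply: bc; lia.
rewrite (@cellEE _ (maxn N N') (c + c')).
  by under eq_bigr do rewrite mulrDl; rewrite big_split/=; lra.
by move=> k kN; rewrite ac ?bc//; lia.
Qed.

Lemma cellEZ x a : eventually_constant R a -> cellE (fun n => x * a n) = x * cellE a.
Proof.
move=> [N [c ac]]; rewrite (@cellEE a N c)// (@cellEE _ N (x * c)).
  rewrite [RHS]mulrDr mulr_sumr [x * (c * _)]mulrA; congr (_ + _).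
  by apply: eq_bigr => k _; rewrite mulrA.
by move=> k /ac ->.
Qed.

Lemma cellE_cst c : cellE (fun=> c) = c.
Proof. by rewrite (@cellEE _ 0%N c)// big_nil -[_ - 1]/(-1 : int) zgN1 Fd_Ntheta; lra. Qed.

Lemma cellE_le a b : eventually_constant R a -> eventually_constant R b ->
  (forall k : nat, a (k%:Z - 1) <= b (k%:Z - 1)) -> cellE a <= cellE b.
Proof.
move=> [N [c ac]] [N' [c' bc]] ab.
rewrite (@cellEE a (maxn N N') c); last by move=> k kN; apply: ac; lia.
rewrite (@cellEE b (maxn N N') c'); last by move=> k kN; apply: bc; lia.
apply: lerD; first by apply: ler_sum => k _; rewrite ler_wpM2r// fg_ge0.
rewrite ler_wpM2r ?subr_ge0 ?Fd_le1//.
by rewrite -(ac (maxn N N')) -?(bc (maxn N N'))//; lia.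
Qed.

(** The constant [r] passes through because the cell probabilities sum to 1. The weights are there
    for K-convexity, which holds cell by cell. *)
Lemma cellE_le_lin w1 w2 w3 r a b c : eventually_constant R a -> eventually_constant R b ->
  eventually_constant R c ->
  (forall k : nat, w1 * a (k%:Z - 1) <= w2 * b (k%:Z - 1) + w3 * c (k%:Z - 1) + r) ->
  w1 * cellE a <= w2 * cellE b + w3 * cellE c + r.
Proof.
move=> ea eb ec abc; rewrite -(cellE_cst r) -!cellEZ//.
rewrite -!cellED//; try by evconst.
by apply: cellE_le abc; evconst.
Qed.

Lemma cellE_leD a b c r : eventually_constant R a -> eventually_constant R b ->
  eventually_constant R c ->
  (forall k : nat, a (k%:Z - 1) <= b (k%:Z - 1) + c (k%:Z - 1) + r) ->
  cellE a <= cellE b + cellE c + r.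
Proof.
move=> ea eb ec abc; rewrite -[cellE a]mul1r -[cellE b]mul1r -[cellE c]mul1r.
by apply: cellE_le_lin => // k; rewrite !mul1r.
Qed.

(** The half-line above [- theta] is cut into finitely many cells and a tail. On each piece [g]
    dominates a constant, whose integral is that constant times an increment of [Fd]. *)
Lemma cellE_le_Rintegral a g : eventually_constant R a ->
  P.-integrable setT (EFin \o g) ->
  (forall (k : nat) d, zg theta (k%:Z - 1) < d -> d <= zg theta (k%:Z - 1) + theta ->
     a (k%:Z - 1) <= g d) ->
  cellE a <= \int[P]_d g d.
Proof.
move=> [N [c ac]] ig ag; rewrite (@cellEE a N c)//.
have iS (A : set R) : measurable A -> P.-integrable A (EFin \o g).
  by move=> mA; exact: integrableS ig.
have cell_le x r (i : itv_bound R) : [set` Interval (BRight x) i] `<=` [set d | r <= g d] ->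
    r * fine (P [set` Interval (BRight x) i]) <= \int[P]_(d in [set` Interval (BRight x) i]) g d.
  move=> rg; rewrite -Rintegral_cst//; apply: le_Rintegral => //; last exact: iS.
  by apply/finite_measure_integrable_cst.
have zNt : zg theta (0%:Z - 1) = - theta by rewrite -zgN1.
have split_le n : \sum_(0 <= k < n) a (k%:Z - 1) * fg M theta t (k%:Z - 1) <=
    \int[P]_(d in `]- theta, zg theta (n%:Z - 1)]) g d.
  elim: n => [|n IH].
    by rewrite big_nil zNt set_itv_ge ?Rintegral_set0// -leNgt bnd_simp.
  rewrite big_nat_recr//= (@itv_bndbnd_setU _ _ _ (BRight (zg theta (n%:Z - 1)))); last 2 first.
  - by rewrite bnd_simp zg_ge.
  - by rewrite bnd_simp zg_pred_nat_le.
  rewrite Rintegral_setU//=.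
  - apply: lerD => //; rewrite /fg zgS -zg_pred_natS -Fd_cell ?zg_pred_nat_le//.
    by apply: cell_le => d /=; rewrite in_itv/= zg_pred_natS => /andP[]; exact: ag.
  - by apply: iS; apply: measurableU.
  - by apply/disj_setPS => d /= []; rewrite !in_itv/= => /andP[_ dz] /andP[]; rewrite ltNge dz.
apply: (le_trans (lerD (split_le N) _)).
  rewrite -Fd_tail; apply: cell_le => d /=; rewrite in_itv/= andbT => zd.
  (* A point of the tail lies in a cell of sequence index [k >= N], where [a] already has its final
     value [c]. *)
  have [z [[m ->] zmd dzm]] := ongrid_ceil R theta theta0 d.
  have Nm : N%:Z - 1 < m.
    by rewrite -(@ltr_int R) -(ltr_pM2r theta0); exact: lt_le_trans zd dzm.
  have [k mk] : exists k : nat, m = k%:Z by exists (absz m); lia.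
  have zk : zg theta m = zg theta (k%:Z - 1) + theta by rewrite -zgS mk subrK.
  by rewrite -(ac k); [apply: ag; lra|lia].
rewrite -Rintegral_setU//=; first last.
- by apply/disj_setPS => d /= []; rewrite !in_itv/= andbT => /andP[_ dz]; rewrite ltNge dz.
- by apply: iS; apply: measurableU.
rewrite -itv_bndbnd_setU ?bnd_simp ?zg_ge//.
rewrite le_eqVlt; apply/orP; left; apply/eqP/esym.
(* The half-line up to [- theta] is null, so the integral over its complement is the full one. *)
rewrite /Rintegral (@negligible_integral _ _ _ _ _ `]-oo, - theta])//.
  congr (fine (integral _ _ _)); apply/seteqP; split=> d /=; rewrite !in_itv/= andbT.
    by move=> [_ /negP]; rewrite -ltNge.
  by move=> h; split=> //; apply/negP; rewrite -ltNge.
by transitivity (Fd M t (- theta))%:E; [rewrite FdE|rewrite Fd_Ntheta].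
Qed.

Lemma cellE_le_lin_Rintegral a b c r g : eventually_constant R a -> eventually_constant R b ->
  eventually_constant R c -> P.-integrable setT (EFin \o g) ->
  (forall (k : nat) d, zg theta (k%:Z - 1) < d -> d <= zg theta (k%:Z - 1) + theta ->
     a (k%:Z - 1) - b (k%:Z - 1) - c (k%:Z - 1) - r <= g d) ->
  cellE a <= cellE b + cellE c + r + \int[P]_d g d.
Proof.
move=> ea eb ec ig abc.
pose e n := a n + (-1 * b n + (-1 * c n + - r)).
have eE : cellE e = cellE a - cellE b - cellE c - r.
  by rewrite /e !cellED ?cellEZ ?cellE_cst//; [lra|..]; evconst.
have : cellE e <= \int[P]_d g d.
  apply: cellE_le_Rintegral => // [|k d kd dk].
    by evconst.
  by have := abc k d kd dk; rewrite /e; lra.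
by rewrite eE; lra.
Qed.

End Expectation.

(** * Convex functions and monotonicity on either side of a minimizer *)

Section Convex.
Variables (R : realType) (f : R -> R).
Hypothesis fconvex : convex_real f.

(** Convexity with weight [(b - a) / (c - a)] on [c], multiplied by [c - a]. This form admits
    [a = c] and matches [Kconvex]. *)
Lemma convex_real_chord a b c : a <= b -> b <= c ->
  (c - a) * f b <= (b - a) * f c + (c - b) * f a.
Proof.
move=> ab bc; have [ac|ac] := ltP a c; last first.
  have -> : b = a by lra.
  have -> : c = a by lra.
  by rewrite !subrr !mul0r addr0.
have ca0 : 0 < c - a by lra.
have ca_neq0 : c - a != 0 by lra.
have /(fconvex c a) : 0 <= (b - a) / (c - a) <= 1.
  by rewrite divr_ge0 ?ler_pdivrMr//=; lra.
have -> : (b - a) / (c - a) * c + (1 - (b - a) / (c - a)) * a = b by field.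
rewrite -(ler_pM2l ca0) => /le_trans; apply.
by rewrite le_eqVlt; apply/orP; left; apply/eqP; field.
Qed.

Variable m : R.
Hypothesis fm : forall y, f m <= f y.

Lemma convex_real_decr x y : x <= y -> y <= m -> f y <= f x.
Proof.
move=> xy ym; have [xm|xm] := ltP x m; last by have -> : x = y by lra.
have mx0 : 0 < m - x by lra.
rewrite -(ler_pM2l mx0); apply: le_trans (convex_real_chord _ _ _ xy ym) _.
by have := fm x; nra.
Qed.

Lemma convex_real_incr x y : m <= x -> x <= y -> f x <= f y.
Proof.
move=> mx xy; have [my|my] := ltP m y; last by have -> : x = y by lra.
have ym0 : 0 < y - m by lra.
rewrite -(ler_pM2l ym0); apply: le_trans (convex_real_chord _ _ _ mx xy) _.
by have := fm y; nra.
Qed.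

End Convex.

(** * The least minimizer of a coercive Lipschitz function *)

Section Argmin.
Variables (R : realType) (f : R -> R) (g : R).
Hypothesis g0 : 0 <= g.
Hypothesis flip : forall x y, `|f x - f y| <= g * `|x - y|.
Hypothesis fcoercive : coercive f.

Let g1 : 0 < g + 1. Proof. by have := g0; lra. Qed.

Lemma lipschitz_continuous : continuous f.
Proof.
move=> x; apply/cvgrPdist_le => /= e e0.
near=> y.
apply: le_trans (flip x y) _.
have : `|x - y| <= e / (g + 1).
  by near: y; apply: cvgr_dist_le; [exact: cvg_id|exact: divr_gt0].
rewrite ler_pdivlMr// => xy.
by have := normr_ge0 (x - y); nra.
Unshelve. all: by end_near. Qed.

Let A := [set y | f y = inf (range f)].

(** Coercivity confines the search to a compact interval, where continuity yields a minimizer [c].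
    The infimum of all minimizers is again one, since minimizers come arbitrarily close to it. *)
Lemma least_argmin : (forall y, f (inf A) <= f y) /\ (forall y, y < inf A -> f (inf A) < f y).
Proof.
have [r0 hr0] := fcoercive (f 0).
pose r := `|r0|; have r_ge0 : 0 <= r := normr_ge0 _.
have far y : r < `|y| -> f 0 < f y by move=> ry; apply: hr0; apply: le_lt_trans ry; exact: ler_norm.
have [||c _ hc] := @EVT_min R f (- r) r; first by lra.
  by apply: continuous_subspaceT => x; exact: lipschitz_continuous.
have fc y : f c <= f y.
  have [yr|yr] := leP `|y| r; first by apply: hc; rewrite in_itv/= -ler_norml.
  by apply: le_trans (ltW (far y yr)); apply: hc; rewrite in_itv/=; lra.
have infE : inf (range f) = f c.
  apply/eqP; rewrite eq_le; apply/andP; split.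
    by apply: ge_inf; [exists (f c) => _ [y _ <-]|exists c].
  by apply: lb_le_inf; [exists (f c), c|move=> _ [y _ <-]].
have Ac : A c by rewrite /A/= infE.
have Alb : has_lbound A.
  exists (- r) => y; rewrite /A/= infE => fyc; have [|/far] := leP `|y| r.
    by rewrite ler_norml => /andP[].
  by rewrite fyc ltNge fc.
have fm : f (inf A) = f c.
  apply/eqP; rewrite eq_le fc andbT leNgt; apply/negP => lt.
  (* A minimizer this close to [inf A] would contradict the Lipschitz bound. Dividing by [g + 1]
     rather than [g] covers [g = 0]. *)
  have e0 : 0 < (f (inf A) - f c) / (g + 1) by rewrite divr_gt0// subr_gt0.
  have [y Ay ye] := inf_adherent e0 (conj (ex_intro _ c Ac) Alb).
  have my : inf A <= y by exact: ge_inf.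
  have fyc : f y = f c by rewrite -infE.
  have := flip (inf A) y; rewrite fyc (distrC (inf A)) (ger0_norm (_ : 0 <= y - inf A)) ?subr_ge0//.
  have := ler_norm (f (inf A) - f c).
  have : (y - inf A) * (g + 1) < f (inf A) - f c by rewrite -ltr_pdivlMr// ltrBlDl.
  by nra.
split=> [y|y ym]; rewrite fm; first exact: fc.
rewrite ltNge; apply/negP => fyc.
suff : inf A <= y by rewrite leNgt ym.
by apply: ge_inf => //; rewrite /A/= infE; apply/eqP; rewrite eq_le fyc fc.
Qed.

End Argmin.

(* Scarf's K-convexity, cleared of denominators and restricted to points of [D]. *)
Definition Kconvex (R : realType) (D : R -> Prop) (K : R) (f : R -> R) :=
  forall a b c, D a -> D b -> D c -> a <= b -> b <= c ->
    (c - a) * f b <= (b - a) * (K + f c) + (c - b) * f a.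

(** * Scarf's K-convexity under an order-up-to policy *)

Section Kconvex.
Variables (R : realType) (D : R -> Prop) (K S s : R) (H : R -> R).
Hypotheses (K0 : 0 <= K) (Ds : D s) (Hs : H s <= H S + K).
Hypothesis HS : forall z, D z -> H S <= H z.
Hypothesis Hconvex : Kconvex R D K H.

(** If [H x <= H s], then [H x <= H S + K] and minimality of [S] suffices. Otherwise K-convexity on
    [s, x, y], with [H s] replaced by the larger [H x], leaves the claim multiplied by [x - s]. *)
Lemma Kconvex_cross x y : D x -> D y -> s <= x -> x <= y -> H x <= K + H y.
Proof.
have [K0' Hs'] := (K0, Hs).
move=> Dx Dy sx xy; have [Hxs|Hsx] := leP (H x) (H s); first by have := HS y Dy; lra.
have xs : 0 < x - s.
  by rewrite subr_gt0 lt_neqAle sx andbT; apply/eqP => e; move: Hsx; rewrite e ltxx.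
by rewrite -(ler_pM2l xs); have := Hconvex _ _ _ Ds Dx Dy sx xy; nra.
Qed.

Let V y := if y < s then H S + K else H y.

Lemma order_up_to_cross x y : D x -> D y -> x <= y -> V x <= K + V y.
Proof.
have [K0' Hs'] := (K0, Hs).
move=> Dx Dy xy; rewrite /V; case: (ltP x s) => xs; case: (ltP y s) => ys.
- lra.
- by have := HS y Dy; lra.
- lra.
- exact: Kconvex_cross.
Qed.

Lemma order_up_to_Kconvex : Kconvex R D K V.
Proof.
have [K0' Hs'] := (K0, Hs).
move=> a b c Da Db Dc ab bc.
rewrite /V; case: (ltP a s) => as_; case: (ltP b s) => bs; case: (ltP c s) => cs; try lra.
- by nra.
- by have := HS c Dc; nra.
(* Here [a < s <= b <= c]. When [H b] exceeds [H S + K], K-convexity is used from [s] instead of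
   [a]; it makes [K + H c - H b] nonnegative, so its coefficient [b - s] may be enlarged to
   [b - a]. *)
- have [HbA|AHb] := leP (H b) (H S + K).
    by have := HS c Dc; nra.
  have sb : 0 < b - s.
    by rewrite subr_gt0 lt_neqAle bs andbT; apply/eqP => e; move: AHb; rewrite -e; lra.
  have h1 := Hconvex _ _ _ Ds Db Dc bs bc.
  have h2 : (c - b) * (H b - (H S + K)) <= (b - s) * (K + H c - H b) by nra.
  have h3 : 0 <= K + H c - H b by rewrite -(pmulr_rge0 _ sb); nra.
  by nra.
- exact: Hconvex.
Qed.

End Kconvex.

(** As the cell index grows, [y - zg theta n] tends to minus infinity and enters the range where [f]
    is constant. *)
Lemma eventually_constant_shift (R : realType) (theta : R) (f : R -> R) (y : R) : 0 < theta ->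
  (exists b c, forall x, x < b -> f x = c) ->
  eventually_constant R (fun n => f (y - zg theta n)).
Proof.
move=> theta0 [b [c fc]].
exists (Num.truncn (`|y - b| / theta)).+2, c => k kN; apply: fc.
have : `|y - b| / theta < (k%:Z - 1)%:~R.
  apply: lt_le_trans (truncnS_gt _) _; by move: (Num.truncn _) kN => n kN; rewrite pmulrn ler_int; lia.
rewrite ltr_pdivrMr// -/(zg theta _) => yb.
by have := ler_norm (y - b); lra.
Qed.

(** Induction on the number of grid steps from [a] to [b], comparing the previous minimizer with the
    new endpoint. *)
Lemma grid_argmin (R : realType) (theta a b : R) (h : R -> R) : 0 < theta ->
  ongrid theta a -> ongrid theta b -> a <= b ->
  exists z, [/\ ongrid theta z, a <= z <= b &
    forall z', ongrid theta z' -> a <= z' <= b -> h z <= h z'].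
Proof.
move=> theta0 ga gb ab.
have [n bE] : exists n : nat, b = a + n%:R * theta.
  case: ga gb ab => i -> [j ->]; rewrite /zg ler_pM2r// ler_int => ij.
  by exists (absz (j - i)); rewrite pmulrn -mulrDl -intrD; congr (_%:~R * _); lia.
elim: n b gb ab bE => [|n IH] b gb ab bE.
  exists a; split=> //; first by rewrite lexx.
  by move=> z' _ z'ab; have -> : z' = a by lra.
have gb' : ongrid theta (b - theta) by apply: ongridB => //; exact: ongrid_theta.
have bE' : b - theta = a + n%:R * theta by rewrite bE -natr1; lra.
have nt : 0 <= n%:R * theta by rewrite mulr_ge0// ltW.
have [|z [gz zab zmin]] := IH _ gb' _ bE'; first by lra.
have [hz|hb] := leP (h z) (h b).
  exists z; split=> //; first by lra.
  move=> z' gz' z'ab; have [z'b|bz'] := ltP z' b.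
    by apply: zmin => //; have := ongrid_gap _ _ theta0 _ _ gz' gb z'b; lra.
  by have -> : z' = b by lra.
exists b; split=> //; first by lra.
move=> z' gz' z'ab; have [z'b|bz'] := ltP z' b.
  apply: le_trans (ltW hb) _.
  by apply: zmin => //; have := ongrid_gap _ _ theta0 _ _ gz' gb z'b; lra.
by have -> : z' = b by lra.
Qed.

(* What the step from period t+1 to period t uses about the functions V_(t+1), V^*_(t+1),
   phi_(t+1), \bar phi_(t+1), \bar omega_(t+1) and the numbers s_(t+1), \bar I_(t+1). *)
Record level_spec (R : realType) (theta K : R) (V Vs : R -> R) (ph phb : R -> R -> R)
    (ob : R -> R) (s Ib : R) : Prop := LevelSpec {
  Ib_le_s : Ib <= s;
  V_const : forall x y, x < s -> y < s -> V x = V y;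
  V_Kconvex : Kconvex R (ongrid theta) K V;
  V_cross : forall g g', ongrid theta g -> ongrid theta g' -> g <= g' -> V g <= K + V g';
  ph_lt : forall x y, y < s -> ph x y = 0;
  ph_homo : forall x x' y y', 0 <= x -> x <= x' -> y <= y' -> ph x y <= ph x' y';
  V_incr : forall h y, 0 <= h -> V y - V (y - h) <= ph h y;
  phb_lt : forall x y, y < s -> phb x y = 0;
  phb_homo : forall g g', ongrid theta g -> ongrid theta g' -> g <= g' ->
    phb theta g <= phb theta g';
  ph_phb : forall y g, ongrid theta g -> y <= g -> ph theta y <= phb theta g;
  V_decr : forall g u, ongrid theta g -> g <= u -> u < g + theta ->
    V g - V u <= phb theta (g + theta);
  ob_const : exists b c, forall x, x < b -> ob x = c;
  ob_homo : forall x y, x <= y -> ob x <= ob y;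
  V_gap : forall x, V x - ob x <= Vs x;
  Vs_cross : forall x y, x <= y -> Vs x <= K + Vs y }.

Arguments Ib_le_s {R theta K V Vs ph phb ob s Ib}.
Arguments V_const {R theta K V Vs ph phb ob s Ib}.
Arguments V_Kconvex {R theta K V Vs ph phb ob s Ib}.
Arguments V_cross {R theta K V Vs ph phb ob s Ib}.
Arguments ph_lt {R theta K V Vs ph phb ob s Ib}.
Arguments ph_homo {R theta K V Vs ph phb ob s Ib}.
Arguments V_incr {R theta K V Vs ph phb ob s Ib}.
Arguments phb_lt {R theta K V Vs ph phb ob s Ib}.
Arguments phb_homo {R theta K V Vs ph phb ob s Ib}.
Arguments ph_phb {R theta K V Vs ph phb ob s Ib}.
Arguments V_decr {R theta K V Vs ph phb ob s Ib}.
Arguments ob_const {R theta K V Vs ph phb ob s Ib}.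
Arguments ob_homo {R theta K V Vs ph phb ob s Ib}.
Arguments V_gap {R theta K V Vs ph phb ob s Ib}.
Arguments Vs_cross {R theta K V Vs ph phb ob s Ib}.

(** * One backward step: the cost function and the grid points it determines *)

Section Step.
Variables (R : realType) (M : model R) (theta : R) (t : nat).
Hypothesis theta0 : 0 < theta.
Hypothesis demand_ge0 : mu M t `]-oo, 0[ = 0%E.
Hypothesis alpha0 : 0 < alpha M.
Hypothesis K0 : 0 <= KK M t.
Hypothesis Cconvex : convex_real (Cf M t).
Hypothesis Ccoercive : coercive (Cf M t).
Variable gam : R.
Hypothesis gam0 : 0 <= gam.
Hypothesis Clip : forall x y, `|Cf M t x - Cf M t y| <= gam * `|x - y|.
Variable K' : R.
Hypothesis KK' : alpha M * K' <= KK M t.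
Variables (V Vs : R -> R) (ph phb : R -> R -> R) (ob : R -> R) (s' Ib' : R).
Hypothesis next : level_spec R theta K' V Vs ph phb ob s' Ib'.
Hypothesis Vs_integrable : forall y,
  (mu M t).-integrable setT (fun d : R => (Vs (y - d))%:E).
Local Notation C := (Cf M t).
Local Notation K := (KK M t).
Local Notation al := (alpha M).
Local Notation m := (Cm M t).
Local Notation SU := (SU M theta t).
Local Notation n0 := (zn0 M theta t).
Local Notation I := (I_of M theta t Ib').
Local Notation Ib := (Ibar_step M theta t Ib').
Local Notation E f y := (cell_expectation R M theta t (fun n => f (y - zg theta n))).
Local Notation grid := (ongrid theta).

Lemma C_min y : C m <= C y.
Proof. exact: (least_argmin R C gam gam0 Clip Ccoercive).1. Qed.

Lemma C_decr x y : x <= y -> y <= m -> C y <= C x.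
Proof. exact: (convex_real_decr R C Cconvex m C_min). Qed.

Lemma C_incr x y : m <= x -> x <= y -> C x <= C y.
Proof. exact: (convex_real_incr R C Cconvex m C_min). Qed.

Lemma C_lip x y : C x - C y <= gam * `|x - y|.
Proof. exact: le_trans (ler_norm _) (Clip x y). Qed.

Lemma far_right b A : exists z, [/\ grid z, b <= z & A < C z].
Proof.
have [r Cr] := Ccoercive A.
have [z [gz _ rz]] := ongrid_ceil R theta theta0 (`|r| + `|b| + theta).
have th := theta0.
exists z; split=> //; first by have := ler_norm b; have := normr_ge0 r; lra.
by apply: Cr; apply: lt_le_trans (ler_norm z); have := normr_ge0 b; have := ler_norm r; lra.
Qed.

Lemma far_left b A : exists z, [/\ grid z, z <= b & A < C z].
Proof.
have [r Cr] := Ccoercive A.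
have [z [gz rz _]] := ongrid_floor R theta theta0 (- (`|r| + `|b| + theta)).
have th := theta0.
exists z; split=> //; first by have := ler_norm (- b); rewrite normrN; have := normr_ge0 r; lra.
apply: Cr; rewrite -normrN; apply: lt_le_trans (ler_norm (- z)).
by have := normr_ge0 b; have := ler_norm r; lra.
Qed.

Lemma n0_spec : [/\ grid n0, n0 < m & m <= n0 + theta].
Proof.
have th := theta0.
have [||gn n0m nmax] := @gmaxP R theta theta0 (fun z => z < m).
- have [z [gz zm _]] := ongrid_ceil R theta theta0 m.
  by exists (z - theta); split=> //; apply: ongridB => //; exact: ongrid_theta.
- by exists m => z /ltW.
split=> //; rewrite leNgt; apply/negP => lt.
have : n0 + theta <= n0 by apply: nmax => //; apply: ongridD => //; exact: ongrid_theta.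
by rewrite /zn0; lra.
Qed.

Lemma SU_spec : [/\ grid SU, m <= SU & C n0 + K < C SU].
Proof.
have [||gS [mS CS] _] := @gminP R theta theta0 (fun z => m <= z /\ C n0 + K < C z).
- by have [z [gz mz Cz]] := far_right m (C n0 + K); exists z.
- by exists m => z [].
by split.
Qed.

Lemma I_spec : [/\ grid I, I < Ib' - theta & I < m].
Proof.
have [||gI] := @gmaxP R theta theta0 (fun z => z < Num.min (Ib' - theta) m).
- have [z [gz zm _]] := ongrid_ceil R theta theta0 (Num.min (Ib' - theta) m).
  by exists (z - theta); split=> //; apply: ongridB => //; exact: ongrid_theta.
- by exists (Num.min (Ib' - theta) m) => z /ltW.
by rewrite lt_min => /andP[]; split.
Qed.

(** The maximizer in [Ibar_step] differs from [I], since [K >= 0] forbids [C I + K < C I]. Hence it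
    lies a full grid step below [I], and adding [theta] does not pass [I]. *)
Lemma Ib_spec : [/\ grid Ib, Ib <= I & C I + K < C (Ib - theta)].
Proof.
have th := theta0; have k0 := K0.
have [gI _ _] := I_spec.
have [||gw [wI Cw] _] := @gmaxP R theta theta0 (fun z => z <= I /\ C I + K < C z).
- by have [z [gz mz Cz]] := far_left I (C I + K); exists z.
- by exists I => z [].
rewrite /Ibar_step addrK; split=> //; first by apply: ongridD => //; exact: ongrid_theta.
apply: ongrid_gap => //; rewrite lt_neqAle wI andbT; apply/eqP => wE.
by move: Cw; rewrite wE; lra.
Qed.

Lemma I_le_SU : I <= SU.
Proof. by have [_ _] := I_spec; have [_ mS _] := SU_spec; lra. Qed.

(** * Cell expectations of the next-period functions *)

Let eV y : eventually_constant R (fun n => V (y - zg theta n)).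
Proof.
apply: eventually_constant_shift => //; exists s', (V (s' - 1)) => x xs.
by apply: (V_const next) => //; lra.
Qed.

Let eph x y : eventually_constant R (fun n => ph x (y - zg theta n)).
Proof.
apply: eventually_constant_shift => //; exists s', 0 => z zs.
exact: (ph_lt next).
Qed.

Let ephb x y : eventually_constant R (fun n => phb x (y - zg theta n)).
Proof.
apply: eventually_constant_shift => //; exists s', 0 => z zs.
exact: (phb_lt next).
Qed.

Let eob y : eventually_constant R (fun n => ob (y - zg theta n)).
Proof. by apply: eventually_constant_shift => //; exact: (ob_const next). Qed.

Let ecst (c : R) := eventually_constant_cst R c.

Lemma ph_ge0 x y : 0 <= x -> 0 <= ph x y.
Proof.
move=> x0; rewrite -(ph_lt next x (Num.min y (s' - 1))).
  by apply: (ph_homo next) => //; rewrite ge_min lexx.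
by rewrite gt_min; apply/orP; right; lra.
Qed.

Lemma Eph_homo x x' y y' : 0 <= x -> x <= x' -> y <= y' -> E (ph x) y <= E (ph x') y'.
Proof.
move=> x0 xx' yy'; apply: cellE_le => // k.
by apply: (ph_homo next) => //; lra.
Qed.

Lemma Eph_ge0 x y : 0 <= x -> 0 <= E (ph x) y.
Proof.
move=> x0; rewrite -(cellE_cst R M theta t theta0 demand_ge0 0).
by apply: cellE_le => // k; exact: ph_ge0.
Qed.

Lemma Ephb_homo g g' : grid g -> grid g' -> g <= g' -> E (phb theta) g <= E (phb theta) g'.
Proof.
move=> gg gg' gle; apply: cellE_le => // k.
by apply: (phb_homo next); try (apply: ongridB => //; exact: ongrid_zg); lra.
Qed.

Lemma Eph_phb y g : grid g -> y <= g -> E (ph theta) y <= E (phb theta) g.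
Proof.
move=> gg yg; apply: cellE_le => // k.
by apply: (ph_phb next); [apply: ongridB => //; exact: ongrid_zg|lra].
Qed.

Lemma Eob_homo x y : x <= y -> E ob x <= E ob y.
Proof.
by move=> xy; apply: cellE_le => // k; apply: (ob_homo next); lra.
Qed.

Lemma EV_cross g g' : grid g -> grid g' -> g <= g' -> E V g <= K' + E V g'.
Proof.
move=> gg gg' gle.
rewrite addrC -[E V g']addr0 -(cellE_cst R M theta t theta0 demand_ge0 0).
apply: cellE_leD => // k; rewrite addr0 [leRHS]addrC.
by apply: (V_cross next); try (apply: ongridB => //; exact: ongrid_zg); lra.
Qed.

Lemma EV_incr h y : 0 <= h -> E V y <= E V (y - h) + E (ph h) y.
Proof.
move=> h0.
rewrite -[leRHS]addr0; apply: cellE_leD => // k; rewrite addr0 -lerBlDl.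
rewrite (_ : y - h - _ = y - zg theta (k%:Z - 1) - h); last by lra.
exact: (V_incr next).
Qed.

Lemma EV_decr g u : grid g -> g <= u -> u < g + theta ->
  E V g <= E V u + E (phb theta) (g + theta).
Proof.
move=> gg gu ug.
rewrite -[leRHS]addr0; apply: cellE_leD => // k; rewrite addr0 -lerBlDl.
rewrite (_ : g + theta - _ = g - zg theta (k%:Z - 1) + theta); last by lra.
by apply: (V_decr next); [apply: ongridB => //; exact: ongrid_zg|lra|lra].
Qed.

Lemma EV_Kconvex a b c : grid a -> grid b -> grid c -> a <= b -> b <= c ->
  (c - a) * E V b <= (b - a) * E V c + (c - b) * E V a + (b - a) * K'.
Proof.
move=> ga gb gc ab bc; apply: cellE_le_lin => // k.
set z := zg _ _; have gz : grid z by exact: ongrid_zg.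
have := V_Kconvex next (a - z) (b - z) (c - z).
rewrite (_ : c - z - (a - z) = c - a); last by lra.
rewrite (_ : b - z - (a - z) = b - a); last by lra.
rewrite (_ : c - z - (b - z) = c - b); last by lra.
move=> h; apply: (le_trans (h _ _ _ _ _)); try exact: ongridB; lra.
Qed.

(** Since [zg] is at least [- theta] on the cells and [I < Ib' - theta], every argument of [V] lies
    below [s'], where [V] is constant. *)
Lemma EV_below y : y <= I -> E V I <= E V y.
Proof.
move=> yI; apply: cellE_le => // k.
have [_ II _] := I_spec; have := zg_ge R theta theta0 k; have := Ib_le_s next.
move=> ? ?; rewrite (V_const next _ (y - zg theta (k%:Z - 1)))//; lra.
Qed.

(** For [d] in the cell starting at [z], the point [x - z] exceeds [x - d] by at most [theta], which
    costs [ph theta]. The passage from [V] to [Vs] then takes place at [x - d] and costs [ob]. *)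
Lemma EV_gap x y r : (forall d, Vs (x - d) <= r + Vs (y - d)) ->
  E V x <= E (ph theta) x + E ob x + r + Ex M t Vs y.
Proof.
move=> Vsr; apply: cellE_le_lin_Rintegral => // [|k d zd dz]; first exact: Vs_integrable.
set z := zg _ _ in zd dz *.
have := Vsr d.
have := V_gap next (x - d).
have : ob (x - d) <= ob (x - z) by apply: (ob_homo next); lra.
have d0 : 0 <= d - z by lra.
have := V_incr next (d - z) (x - z) d0.
rewrite (_ : x - z - (d - z) = x - d); last by lra.
have : ph (d - z) (x - z) <= ph theta (x - z).
  by apply: (ph_homo next); lra.
lra.
Qed.

Lemma EV_grid_gap g y : grid g -> g - theta < y -> y <= g ->
  E V (g - theta) <= E (phb theta) g + E ob g + Ex M t Vs y.
Proof.
move=> gg gy yg; rewrite -[_ + E ob g]addr0.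
apply: cellE_le_lin_Rintegral => // [|k d zd dz]; first exact: Vs_integrable.
have gz : grid (g - zg theta (k%:Z - 1)) by apply: ongridB => //; exact: ongrid_zg.
set z := zg _ _ in zd dz gz *.
have th := theta0.
have := V_gap next (y - d).
have : ob (y - d) <= ob (g - z) by apply: (ob_homo next); lra.
suff : V (g - theta - z) - V (y - d) <= phb theta (g - z) by lra.
rewrite (_ : g - theta - z = g - z - theta); last by lra.
have gz' : grid (g - z - theta) by apply: ongridB => //; exact: ongrid_theta.
(* The exact argument [y - d] is within [theta] of the grid point [g - z - theta], on either side.
   To its right the decrease bound applies, to its left the increase bound, dominated by [phb]
   through [ph_phb]. *)
have [uv|vu] := leP (y - d) (g - z - theta); last first.
  have := V_decr next (g - z - theta) (y - d) gz'.
  by rewrite subrK; apply; lra.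
pose h := g - z - theta - (y - d).
have h0 : 0 <= h by rewrite /h; lra.
have := V_incr next h (g - z - theta) h0.
rewrite /h (_ : g - z - theta - _ = y - d); last by lra.
move=> /le_trans; apply.
apply: (@le_trans _ _ (ph theta (g - z - theta))).
  by apply: (ph_homo next); lra.
by apply: (ph_phb next) => //; lra.
Qed.

(** * Estimates for [H] and its distance to the exact [Hs] *)

Variables (H Hs om : R -> R) (psi psib : R -> R -> R).
Hypothesis HE : forall y, H y = C y + al * E V y.
Hypothesis HsE : forall y, Hs y = C y + al * Ex M t Vs y.
Hypothesis psiE : forall x y, psi x y = gam * x + al * E (ph x) y.
Hypothesis psibE : forall x y, psib x y = gam * x + al * E (phb x) y.
Hypothesis omE : forall x, om x = psi theta x - gam * theta + al * E ob x.

Let alM a b : a <= b -> al * a <= al * b.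
Proof. by move=> ab; rewrite ler_wpM2l// ltW. Qed.

Lemma H_Kconvex : Kconvex R grid K H.
Proof.
move=> a b c ga gb gc ab bc; rewrite !HE.
have hC := convex_real_chord _ _ Cconvex _ _ _ ab bc.
have hE := alM _ _ (EV_Kconvex _ _ _ ga gb gc ab bc).
have hK : (b - a) * (al * K') <= (b - a) * K by rewrite ler_wpM2l// subr_ge0.
lra.
Qed.

Lemma H_below z : z <= I -> H I - C I <= H z - C z.
Proof. by move=> zI; have := alM _ _ (EV_below _ zI); rewrite !HE; lra. Qed.

(** By the choice of [SU], the cost [C z] exceeds [C n0 + K], and this covers the discounted
    crossing cost [al * K'] of [EV_cross]. *)
Lemma H_n0_SU z : grid z -> SU <= z -> H n0 <= H z.
Proof.
move=> gz Sz; have kk := KK'.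
have [gn n0m _] := n0_spec; have [_ mS CS] := SU_spec.
have Cz : C SU <= C z by exact: C_incr.
have n0z : n0 <= z by lra.
by have := alM _ _ (EV_cross _ _ gn gz n0z); rewrite !HE; lra.
Qed.

Lemma psi_homo x x' y y' : 0 <= x -> x <= x' -> y <= y' -> psi x y <= psi x' y'.
Proof.
move=> x0 xx' yy'; rewrite !psiE; apply: lerD; first by rewrite ler_wpM2l.
by apply: alM; exact: Eph_homo.
Qed.

Lemma psi_ge0 x y : 0 <= x -> 0 <= psi x y.
Proof.
move=> x0; rewrite psiE addr_ge0// mulr_ge0//; last exact: Eph_ge0.
exact: ltW.
Qed.

Lemma psib_homo g g' : grid g -> grid g' -> g <= g' -> psib theta g <= psib theta g'.
Proof. by move=> gg gg' gle; rewrite !psibE lerD2l; apply: alM; exact: Ephb_homo. Qed.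

Lemma psi_psib y g : grid g -> y <= g -> psi theta y <= psib theta g.
Proof. by move=> gg yg; rewrite psiE psibE lerD2l; apply: alM; exact: Eph_phb. Qed.

Lemma psib_ge0 g : grid g -> 0 <= psib theta g.
Proof.
by move=> gg; apply: le_trans (psi_ge0 theta g _) (psi_psib _ _ gg (lexx _)); exact: ltW.
Qed.

Lemma om_homo x y : x <= y -> om x <= om y.
Proof.
move=> xy; rewrite !omE; apply: lerD; last by apply: alM; exact: Eob_homo.
by rewrite lerD2r; apply: psi_homo => //; exact: ltW.
Qed.

Lemma H_incr h y : 0 <= h -> H y - H (y - h) <= psi h y.
Proof.
move=> h0; have := alM _ _ (EV_incr h y h0); have := C_lip y (y - h).
by rewrite !HE psiE subKr ger0_norm//; lra.
Qed.

Lemma H_decr g u : grid g -> g <= u -> u < g + theta -> H g - H u <= psib theta (g + theta).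
Proof.
move=> gg gu ug; have := alM _ _ (EV_decr g u gg gu ug); have := C_lip g u.
rewrite !HE psibE distrC ger0_norm ?subr_ge0//.
have : gam * (u - g) <= gam * theta by rewrite ler_wpM2l//; lra.
lra.
Qed.

(** The term [gam * theta] cancels, so [om x] is the discounted sum of the expectations of
    [ph theta] and [ob]. The disjunction lets one statement serve both [x = y] with [r = 0] and a
    genuine order with [r = K']. *)
Lemma H_gap x y r : x <= y -> (forall u v, u <= v -> u = v \/ x < y -> Vs u <= r + Vs v) ->
  H x - Hs y <= C x - C y + om x + al * r.
Proof.
move=> xy Vsr; have := alM _ _ (EV_gap x y r _).
rewrite HE HsE omE psiE => h.
suff : al * E V x <= al * (E (ph theta) x + E ob x + r + Ex M t Vs y) by lra.
apply: h => d; apply: Vsr; first by lra.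
by move: xy; rewrite le_eqVlt => /orP[/eqP ->|]; [left|right].
Qed.

Lemma H_gap_same x : H x - Hs x <= om x.
Proof.
have := H_gap x x 0 (lexx x) _; rewrite subrr mulr0 add0r addr0; apply.
by move=> u v _ [->|]; rewrite ?ltxx// add0r.
Qed.

Lemma H_gap_cross x y : x <= y -> H x - Hs y <= C x - C y + om x + K.
Proof.
move=> xy; apply: le_trans (H_gap x y K' xy _) _; last by rewrite lerD2l.
by move=> u v uv _; exact: (Vs_cross next).
Qed.

Lemma H_grid_gap g y : grid g -> g - theta < y -> y <= g ->
  H (g - theta) - Hs y <= psib theta g + al * E ob g.
Proof.
move=> gg gy yg; have := alM _ _ (EV_grid_gap g y gg gy yg); have := C_lip (g - theta) y.
rewrite HE HsE psibE distrC ger0_norm ?subr_ge0//; last exact: ltW.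
have : gam * (y - (g - theta)) <= gam * theta by rewrite ler_wpM2l//; lra.
lra.
Qed.

(** Left of [m] the cost [C] decreases, so rounding down incurs no Lipschitz term and only the [ph]
    part of [psi] remains. *)
Lemma H_floor x z : z <= x -> x < z + theta -> x <= m -> H x - H z <= psi theta x - gam * theta.
Proof.
move=> zx xz xm; have := C_decr _ _ zx xm.
have h0 : 0 <= x - z by lra.
have := alM _ _ (EV_incr (x - z) x h0); rewrite subKr.
have : al * E (ph (x - z)) x <= al * E (ph theta) x.
  by apply: alM; apply: Eph_homo => //; lra.
by rewrite !HE psiE; lra.
Qed.

Local Notation eta := (psib theta SU + om SU).

(** Besides the grid error, [eta] contains the summand [psi theta SU - gam * theta]. It is kept on
    the left as slack to pay for rounding the initial stock down to the grid. *)
Lemma H_grid_gap_eta g y : grid g -> g - theta < y -> y <= g -> g <= SU ->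
  H (g - theta) - Hs y + (psi theta SU - gam * theta) <= eta.
Proof.
move=> gg gy yg gS; have := H_grid_gap g y gg gy yg.
have [gSU _ _] := SU_spec.
have := psib_homo g SU gg gSU gS; have := alM _ _ (Eob_homo _ _ gS).
by rewrite omE; lra.
Qed.

Lemma psi_excess_ge0 : 0 <= psi theta SU - gam * theta.
Proof.
by rewrite psiE [gam * _ + _]addrC addrK mulr_ge0 ?Eph_ge0 ?ltW.
Qed.

(** Beyond [SU] the cost [C y] exceeds [C n0 + K], which absorbs the setup cost in [H_gap_cross]. *)
Lemma H_n0_gap y : SU <= y -> H n0 - Hs y <= om SU.
Proof.
move=> Sy; have [_ n0m _] := n0_spec; have [_ mS CS] := SU_spec.
have CSy : C SU <= C y by exact: C_incr.
have n0y : n0 <= y by lra.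
have n0S : n0 <= SU by lra.
by have := H_gap_cross n0 y n0y; have := om_homo _ _ n0S; lra.
Qed.

(** * The order-up-to level [S] and the reorder point [s] *)

Variables S s : R.
Hypothesis SE : S = gmax theta (fun z => I <= z <= SU /\
  forall z', grid z' -> I <= z' <= SU -> H z <= H z').
Hypothesis sE : s = if K == 0 then S else
  gmin theta (fun z => Ib <= z <= S /\ H z <= H S + K).

(** Minimality extends from the search window to the whole grid: left of [I] by [H_below] and the
    decrease of [C], right of [SU] by comparison with [n0], which lies in the window because
    [I < m <= n0 + theta]. *)
Lemma S_spec : [/\ grid S, I <= S <= SU & forall z, grid z -> H S <= H z].
Proof.
have [gI _ Im] := I_spec; have [gS _ _] := SU_spec.
have [||gSm [Sm Smin] _] := @gmaxP R theta theta0 (fun z => I <= z <= SU /\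
  forall z', grid z' -> I <= z' <= SU -> H z <= H z').
- have [z [gz zI zmin]] := grid_argmin R theta I SU H theta0 gI gS I_le_SU.
  by exists z.
- by exists SU => z [/andP[]].
rewrite SE; split=> // z gz.
have [zI|Iz] := leP z I.
  apply: (le_trans (Smin I gI _)); first by rewrite lexx I_le_SU.
  by have := H_below z zI; have := C_decr _ _ zI (ltW Im); lra.
have [zS|Sz] := leP z SU; first by apply: Smin => //; rewrite ltW.
apply: le_trans (H_n0_SU z gz (ltW Sz)).
have [gn n0m mn0] := n0_spec; have [_ mS _] := SU_spec.
apply: Smin => //; rewrite (_ : n0 <= SU) ?andbT; last by lra.
rewrite leNgt; apply/negP => n0I.
by have := ongrid_gap _ _ theta0 _ _ gn gI n0I; lra.
Qed.

(** Between [Ib] and [s] the last claim is the minimality of [s]. Below [Ib] the cost [C] already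
    exceeds [C I + K], and [H - C] is no smaller than at [I]. For [K = 0] it is the minimality of
    [S]. *)
Lemma s_spec : [/\ grid s, Ib <= s <= S, H s <= H S + K &
  forall z, grid z -> z < s -> H S + K <= H z].
Proof.
have [gS /andP[IS _] Smin] := S_spec; have [gIb IbI CIb] := Ib_spec; have k0 := K0.
rewrite sE; case: eqP => [->|_].
  by rewrite lexx addr0 andbT (le_trans IbI IS); split=> // z gz _; exact: Smin.
have [||gs [Ibs Hs_] smin] := @gminP R theta theta0 (fun z => Ib <= z <= S /\ H z <= H S + K).
- by exists S; split=> //; rewrite lexx (le_trans IbI IS) lerDl.
- by exists Ib => z [/andP[]].
split=> // z gz zs; have [Ibz|zIb] := leP Ib z.
  apply: ltW; rewrite ltNge; apply/negP => Hz.
  have /smin : Ib <= z <= S /\ H z <= H S + K.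
    by split=> //; rewrite Ibz; case/andP: Ibs => _; apply: le_trans; exact: ltW.
  by move=> /(_ gz); rewrite leNgt zs.
have th := theta0; have [gI _ Im] := I_spec.
have zIb' : z <= Ib - theta by have := ongrid_gap _ _ theta0 _ _ gz gIb zIb; lra.
have zI : z <= I by lra.
have := H_below z zI; have := Smin I gI.
have IbIm : Ib - theta <= m by lra.
by have := C_decr _ _ zIb' IbIm; lra.
Qed.

(** * The value functions of the current period and their gap *)

Variables (Vt Vts : R -> R) (phi phib : R -> R -> R) (obar : R -> R).
Hypothesis VtE : forall y, Vt y = if y < s then H S + K else H y.
Hypothesis VtsE : forall x, Vts x = inf [set K * delta (y - x) + Hs y | y in `[x, +oo[].
Hypothesis phiE : forall x y, phi x y =
  if y < s then 0 else if y - x < s then psi (y - s) y else psi x y.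
Hypothesis phibE : forall x y, phib x y =
  if y < s then 0 else if y - x < s then psib (y - s + theta) y else psib x y.
Hypothesis obarE : forall x, obar x = if x <= SU then eta else Num.max eta (om x).

Lemma om_le_obar x : om x <= obar x.
Proof.
have [gS _ _] := SU_spec.
rewrite obarE; case: (leP x SU) => [xS|_]; last by rewrite le_max lexx orbT.
by have := om_homo _ _ xS; have := psib_ge0 SU gS; lra.
Qed.

Lemma eta_le_obar x : eta <= obar x.
Proof. by rewrite obarE; case: (leP x SU) => // _; rewrite le_max lexx. Qed.

Lemma obar_homo x y : x <= y -> obar x <= obar y.
Proof.
move=> xy; rewrite (obarE x); case: (leP x SU) => [_|Sx]; first exact: eta_le_obar.
by rewrite ge_max eta_le_obar (le_trans (om_homo _ _ xy) (om_le_obar y)).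
Qed.

(** The middle branch of [phib] is reached on the grid only at [g = s], and there [g - s + theta] is
    [theta]. *)
Lemma phib_theta g : grid g -> phib theta g = if g < s then 0 else psib theta g.
Proof.
move=> gg; have [gs _ _ _] := s_spec; rewrite phibE; case: ltP => // sg.
case: ltP => // gts; have -> : g = s.
  apply/eqP; rewrite eq_le sg andbT leNgt; apply/negP => lt.
  by have := ongrid_gap _ _ theta0 _ _ gs gg lt; lra.
by rewrite subrr add0r.
Qed.

Lemma phib_homo g g' : grid g -> grid g' -> g <= g' -> phib theta g <= phib theta g'.
Proof.
move=> gg gg' gle; rewrite !phib_theta//; case: ltP => gs; case: ltP => g's //.
- exact: psib_ge0.
- by move: g's; rewrite ltNge (le_trans gs gle).
- exact: psib_homo.
Qed.

(** Merging the two branches into a minimum makes the monotonicity of [phi] follow from that of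
    [psi]. *)
Lemma phi_min x y : s <= y -> phi x y = psi (Num.min x (y - s)) y.
Proof.
move=> sy; rewrite phiE ltNge sy/=; case: ltP => h.
  by rewrite min_r//; lra.
by rewrite min_l//; lra.
Qed.

Lemma phi_ge0 x y : 0 <= x -> 0 <= phi x y.
Proof.
move=> x0; have [sy|ys] := leP s y; last by rewrite phiE ys.
by rewrite phi_min// psi_ge0// le_min x0 subr_ge0.
Qed.

Lemma phi_homo x x' y y' : 0 <= x -> x <= x' -> y <= y' -> phi x y <= phi x' y'.
Proof.
move=> x0 xx' yy'; have [sy|ys] := leP s y; last first.
  by rewrite phiE ys phi_ge0//; lra.
rewrite !phi_min//; last exact: le_trans yy'.
apply: psi_homo => //; first by rewrite le_min x0 subr_ge0.
by rewrite le_min !ge_min xx' lerD2r yy' !orbT.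
Qed.

Lemma phi_phib y g : grid g -> y <= g -> phi theta y <= phib theta g.
Proof.
move=> gg yg; rewrite phib_theta//; have [sy|ys] := leP s y; last first.
  by rewrite phiE ys; case: ltP => // _; exact: psib_ge0.
rewrite ltNge (le_trans sy yg)/= phi_min//; apply: le_trans (psi_psib _ _ gg yg).
apply: psi_homo => //; first by rewrite le_min subr_ge0 sy ltW.
by rewrite ge_min lexx.
Qed.

Lemma Vt_incr h y : 0 <= h -> Vt y - Vt (y - h) <= phi h y.
Proof.
move=> h0; have [_ _ Hsle _] := s_spec.
rewrite !VtE phiE; case: (ltP y s) => ys; case: (ltP (y - h) s) => yhs; try lra.
- by have := H_incr (y - s) y; rewrite subKr subr_ge0 => /(_ ys); lra.
- exact: H_incr.
Qed.

(** As [g] and [s] are grid points, [g < s] forces [u < g + theta <= s], so both values are the same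
    constant. Otherwise both are values of [H]. *)
Lemma Vt_decr g u : grid g -> g <= u -> u < g + theta -> Vt g - Vt u <= phib theta (g + theta).
Proof.
move=> gg gu ug; have [gs _ _ _] := s_spec; have th := theta0.
have gg' : grid (g + theta) by apply: ongridD => //; exact: ongrid_theta.
rewrite !VtE phib_theta//; case: (ltP g s) => gs_.
  have := ongrid_gap _ _ theta0 _ _ gg gs gs_ => gts.
  rewrite (_ : u < s = true) ?subrr; last by apply/idP; lra.
  by case: ltP => // _; exact: psib_ge0.
rewrite ltNge (le_trans gs_ gu)/= ltNge (_ : s <= g + theta)/=; last by lra.
exact: H_decr.
Qed.

Lemma Vt_gap x y : x <= y -> Vt x - obar x <= K * delta (y - x) + Hs y.
Proof.
move=> xy; have th := theta0; have k0 := K0.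
have [gSU mSU CSU] := SU_spec; have [gS /andP[IS SSU] Smin] := S_spec.
have [gs /andP[Ibs sS] Hsle sbelow] := s_spec.
have [gn n0m mn0] := n0_spec.
have et := eta_le_obar x; have omo := om_le_obar x; have ps := psib_ge0 SU gSU.
have px := psi_excess_ge0.
rewrite /delta subr_gt0; move: xy; rewrite le_eqVlt => /orP[/eqP <-|xy].
  rewrite ltxx mulr0 add0r VtE; case: ltP => xs; last by have := H_gap_same x; lra.
  (* Nothing is ordered although [x < s]. The grid point [g - theta] just below [x] is also below
     [s], so [H S + K] is at most its [H]-value. *)
  have [g [gg gx xg]] := ongrid_ceil R theta theta0 x.
  have gles : g <= s.
    rewrite leNgt; apply/negP => sg; have := ongrid_gap _ _ theta0 _ _ gs gg sg; lra.
  have gSle : g <= SU by lra.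
  have gg' : grid (g - theta) by apply: ongridB => //; exact: ongrid_theta.
  have gts : g - theta < s by lra.
  by have := H_grid_gap_eta g x gg gx xg gSle; have := sbelow _ gg' gts; lra.
rewrite xy mulr1 VtE; case: ltP => xs.
  (* From below [s] both sides pay [K], and [H S] is bounded by [H] at [n0] or at the grid point
     just below [y]. *)
  have [yS|Sy] := leP y SU; last first.
    by have := H_n0_gap y (ltW Sy); have := Smin n0 gn; lra.
  have [g [gg gy yg]] := ongrid_ceil R theta theta0 y.
  have gSle : g <= SU.
    rewrite leNgt; apply/negP => Sg; have := ongrid_gap _ _ theta0 _ _ gSU gg Sg; lra.
  have gg' : grid (g - theta) by apply: ongridB => //; exact: ongrid_theta.
  by have := H_grid_gap_eta g y gg gy yg gSle; have := Smin _ gg'; lra.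
have [mx|xm] := leP m x.
  by have := H_gap_cross x y (ltW xy); have := C_incr _ _ mx (ltW xy); lra.
(* For [s <= x < m] the stock is rounded down to [z]. The grid crossing inequality then links [z] to
   [n0] when [y > SU], and to the grid point just below [y] otherwise. *)
have [z [gz zx xz]] := ongrid_floor R theta theta0 x.
have sz : s <= z.
  rewrite leNgt; apply/negP => zs; have := ongrid_gap _ _ theta0 _ _ gz gs zs; lra.
have Hcross w : grid w -> z <= w -> H z <= K + H w.
  move=> gw zw.
  exact: (Kconvex_cross R grid K S s H K0 gs Hsle Smin H_Kconvex z w gz gw sz zw).
have xSU : x <= SU by lra.
have hx := H_floor x z zx xz (ltW xm).
have th0 : 0 <= theta by lra.
have hpsi := psi_homo theta theta x SU th0 (lexx _) xSU.
have [yS|Sy] := leP y SU; last first.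
  have zn0 : z <= n0.
    rewrite leNgt; apply/negP => lt; have := ongrid_gap _ _ theta0 _ _ gn gz lt; lra.
  have := H_n0_gap y (ltW Sy); have := Hcross n0 gn zn0; have := psi_psib SU SU gSU (lexx _).
  have : 0 <= gam * theta by exact: mulr_ge0.
  lra.
have [g [gg gy yg]] := ongrid_ceil R theta theta0 y.
have gSle : g <= SU.
  rewrite leNgt; apply/negP => Sg; have := ongrid_gap _ _ theta0 _ _ gSU gg Sg; lra.
have gg' : grid (g - theta) by apply: ongridB => //; exact: ongrid_theta.
have zg' : z <= g - theta.
  have zg_ : z < g by lra.
  by have := ongrid_gap _ _ theta0 _ _ gz gg zg_; lra.
by have := H_grid_gap_eta g y gg gy yg gSle; have := Hcross _ gg' zg'; lra.
Qed.

Lemma level_spec_step : level_spec R theta K Vt Vts phi phib obar s Ib.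
Proof.
have [gs /andP[Ibs _] Hsle _] := s_spec; have [_ _ Smin] := S_spec.
(* This lower bound yields [V_gap], and it also keeps the infimum defining [Vts] from being a
   default value. *)
have Vt_lb x : lbound [set K * delta (y - x) + Hs y | y in `[x, +oo[] (Vt x - obar x).
  by move=> _ [y /= + <-]; rewrite in_itv/= andbT; exact: Vt_gap.
split=> //.
- by move=> x y xs ys; rewrite !VtE xs ys.
- rewrite (_ : Vt = fun y => if y < s then H S + K else H y); last exact/funext.
  exact: order_up_to_Kconvex H_Kconvex.
- move=> g g' gg gg' gle; rewrite !VtE.
  exact: (order_up_to_cross R grid K S s H K0 gs Hsle Smin H_Kconvex).
- by move=> x y ys; rewrite phiE ys.
- exact: phi_homo.
- exact: Vt_incr.
- by move=> x y ys; rewrite phibE ys.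
- exact: phib_homo.
- exact: phi_phib.
- exact: Vt_decr.
- by exists SU, eta => x xS; rewrite obarE ltW.
- exact: obar_homo.
- move=> x; rewrite VtsE; apply: lb_le_inf => //.
  by exists (K * delta (x - x) + Hs x), x => //=; rewrite in_itv/= lexx.
(* Every level [z] reachable from [y] is reachable from [x <= y], at an additional setup cost of at
   most [K]. *)
- move=> x y xy; rewrite -lerBlDl (VtsE y); apply: lb_le_inf.
    by exists (K * delta (y - y) + Hs y), y => //=; rewrite in_itv/= lexx.
  move=> _ [z /= + <-]; rewrite in_itv/= andbT => yz.
  have xz := le_trans xy yz.
  have : Vts x <= K * delta (z - x) + Hs z.
    by rewrite VtsE; apply: ge_inf; [exists (Vt x - obar x)|exists z => //=; rewrite in_itv/= xz].
  have : K * delta (z - x) <= K.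
    by rewrite /delta; case: ifP; rewrite ?mulr1 ?mulr0.
  have : 0 <= K * delta (z - y).
    by rewrite /delta; case: ifP; rewrite ?mulr1 ?mulr0.
  lra.
Qed.

End Step.

(** Truncation loses nothing: past index [floor ((y - s) / theta)] the argument [y - z_n] is below
    [s], where [ph] vanishes. If [y < s - theta] this holds for every cell. *)
Lemma psi_ofE (R : realType) (M : model R) (theta sT : R) (gamma : nat -> R) (t : nat)
    (ph : R -> R -> R) (x y : R) :
  0 < theta -> mu M t `]-oo, 0[ = 0%E ->
  (forall x y, y < sg M theta sT t.+1 -> ph x y = 0) ->
  psi_of M theta sT gamma t ph x y =
  gamma t * x + alpha M * cell_expectation R M theta t (fun n => ph x (y - zg theta n)).
Proof.
move=> theta0 demand_ge0 ph0; rewrite /psi_of; set s := sg _ _ _ _ in ph0 *.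
have cellE0 N := @cellEE R M theta t theta0 demand_ge0 (fun n => ph x (y - zg theta n)) N 0.
case: ltP => ys.
  rewrite (cellE0 0%N) ?big_nil ?mul0r ?addr0 ?mulr0 ?addr0// => k _.
  by apply: ph0; have := zg_ge R theta theta0 k; lra.
(* The floor is at least -1, so [absz] acts on a positive integer and counts the indices from -1 up
   to the floor. *)
set N := absz _; have floor_ge : - 1 <= Num.floor ((y - s) / theta).
  by rewrite floor_ge_int rmorphN1 ler_pdivlMr//; lra.
rewrite (cellE0 N) ?mul0r ?addr0// => k Nk; apply: ph0.
have : (y - s) / theta < (k%:Z - 1)%:~R.
  rewrite -floor_lt_int; move: (Num.floor _) floor_ge @N Nk => q floor_ge N Nk; lia.
by rewrite ltr_pdivrMr// -/(zg theta _); lra.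
Qed.

Lemma Ex0 (R : realType) (M : model R) (t : nat) (y : R) : Ex M t (fun=> 0) y = 0.
Proof. by rewrite /Ex integral0. Qed.

(** * The last period, where the values are exact *)

Section LastPeriod.
Variables (R : realType) (M : model R) (theta sT : R) (t : nat).
Local Notation C := (Cf M t).
Local Notation K := (KK M t).
Local Notation m := (Cm M t).
Hypothesis theta0 : 0 < theta.
Hypothesis K0 : 0 <= K.
Hypothesis Cconvex : convex_real C.
Hypothesis Ccoercive : coercive C.
Variable gam : R.
Hypothesis gam0 : 0 <= gam.
Hypothesis Clip : forall x y, `|C x - C y| <= gam * `|x - y|.
Hypothesis sTm : sT <= m.
Hypothesis CsT : C sT = C m + K.
Variables (V Vs : R -> R) (ph : R -> R -> R).
Hypothesis VE : forall y, V y = if y < sT then C m + K else C y.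
Hypothesis VsE : forall x, Vs x = inf [set K * delta (y - x) + C y | y in `[x, +oo[].
Hypothesis phE : forall x y, ph x y = if y < sT then 0 else gam * x.

Let C_min y : C m <= C y := C_min R M t Ccoercive gam gam0 Clip y.

(** The equation for [C sT] makes [V y] equal to [C] at the larger of [y] and [sT], so [V] inherits
    the Lipschitz bound. *)
Lemma last_V_incr h y : 0 <= h -> V y - V (y - h) <= ph h y.
Proof.
move=> h0; rewrite !VE phE -CsT; case: (ltP y sT) => ys; case: (ltP (y - h) sT) => yhs; try lra.
- have := C_lip R M t gam Clip y sT; rewrite ger0_norm ?subr_ge0//.
  have : gam * (y - sT) <= gam * h by apply: ler_wpM2l => //; lra.
  lra.
- by have := C_lip R M t gam Clip y (y - h); rewrite subKr ger0_norm.
Qed.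

Lemma last_ph_homo x x' y y' : 0 <= x -> x <= x' -> y <= y' -> ph x y <= ph x' y'.
Proof.
move=> x0 xx' yy'; rewrite !phE; case: (ltP y sT) => ys; case: (ltP y' sT) => ys' //.
- by rewrite mulr_ge0//; lra.
- lra.
- by rewrite ler_wpM2l.
Qed.

Lemma last_V_decr g u : g <= u -> u < g + theta -> V g - V u <= ph theta (g + theta).
Proof.
move=> gu ug; rewrite !VE phE -CsT; case: (ltP g sT) => gs; case: (ltP u sT) => us; try lra.
- by rewrite subrr; case: ltP => // _; rewrite mulr_ge0// ltW.
- rewrite ltNge (_ : sT <= g + theta)/=; last by lra.
  have := C_lip R M t gam Clip sT u; rewrite distrC ger0_norm ?subr_ge0//.
  have : gam * (u - sT) <= gam * theta by apply: ler_wpM2l => //; lra.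
  lra.
- rewrite ltNge (_ : sT <= g + theta)/=; last by lra.
  have := C_lip R M t gam Clip g u; rewrite distrC ger0_norm ?subr_ge0//.
  have : gam * (u - g) <= gam * theta by apply: ler_wpM2l => //; lra.
  lra.
Qed.

(** Between [sT] and [m] the cost is at most [C sT = C m + K], hence at most [K + C y]. To the right
    of [m] the cost increases, and ordering cannot help. *)
Lemma last_V_gap x y : x <= y -> V x <= K * delta (y - x) + C y.
Proof.
have [k0 cs] := (K0, CsT); rewrite VE /delta subr_gt0 le_eqVlt => /orP[/eqP <-|xy].
  rewrite ltxx mulr0 add0r; case: ltP => // xs; rewrite -CsT.
  exact: (C_decr R M t Cconvex Ccoercive gam gam0 Clip x sT (ltW xs) sTm).
rewrite xy mulr1; have Cy := C_min y; case: ltP => xs; first by lra.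
have [mx|xm] := leP m x.
  by have := C_incr R M t Cconvex Ccoercive gam gam0 Clip x y mx (ltW xy); lra.
by have := C_decr R M t Cconvex Ccoercive gam gam0 Clip sT x xs (ltW xm); lra.
Qed.

Lemma level_spec_last : level_spec R theta K V Vs ph ph (fun=> 0) sT sT.
Proof.
have k0 := K0; have th := theta0.
(* The point [sT] need not lie on the grid, so Scarf's lemmas are applied with all reals as domain
   and then restricted. *)
have CK : Kconvex R (fun=> True) K C.
  move=> a b c _ _ _ ab bc; have := convex_real_chord R C Cconvex a b c ab bc.
  have : 0 <= (b - a) * K by rewrite mulr_ge0 ?subr_ge0.
  lra.
have CsT' : C sT <= C m + K by rewrite CsT.
have V_lb x : lbound [set K * delta (y - x) + C y | y in `[x, +oo[] (V x).
  by move=> _ [y /= + <-]; rewrite in_itv/= andbT; exact: last_V_gap.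
split=> //.
- by move=> x y xs ys; rewrite !VE xs ys.
- rewrite (_ : V = fun y => if y < sT then C m + K else C y); last exact/funext.
  move=> a b c _ _ _.
  exact: (order_up_to_Kconvex R (fun=> True) K m sT C k0 Logic.I CsT' (fun z _ => C_min z) CK).
- move=> g g' _ _ gle; rewrite !VE.
  exact: (order_up_to_cross R (fun=> True) K m sT C k0 Logic.I CsT' (fun z _ => C_min z) CK).
- by move=> x y ys; rewrite phE ys.
- exact: last_ph_homo.
- exact: last_V_incr.
- by move=> x y ys; rewrite phE ys.
- by move=> g g' _ _ gle; apply: last_ph_homo => //; exact: ltW.
- by move=> y g _ yg; apply: last_ph_homo => //; exact: ltW.
- by move=> g u _; exact: last_V_decr.
- by exists 0, 0.
- move=> x; rewrite subr0 VsE; apply: lb_le_inf => //.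
  by exists (K * delta (x - x) + C x), x => //=; rewrite in_itv/= lexx.
- move=> x y xy; rewrite -lerBlDl (VsE y); apply: lb_le_inf.
    by exists (K * delta (y - y) + C y), y => //=; rewrite in_itv/= lexx.
  move=> _ [z /= + <-]; rewrite in_itv/= andbT => yz.
  have xz := le_trans xy yz.
  have : Vs x <= K * delta (z - x) + C z.
    by rewrite VsE; apply: ge_inf; [exists (V x)|exists z => //=; rewrite in_itv/= xz].
  have : K * delta (z - x) <= K.
    by rewrite /delta; case: ifP; rewrite ?mulr1 ?mulr0.
  have : 0 <= K * delta (z - y).
    by rewrite /delta; case: ifP; rewrite ?mulr1 ?mulr0.
  lra.
Qed.

End LastPeriod.

(** * One-step unfolding of the recursive definitions *)

Section Recursion.
Variables (R : realType) (M : model R) (theta sT : R) (gamma : nat -> R) (t : nat).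

Lemma VgE y : Vg M theta sT t y =
  if y < sg M theta sT t then Hg M theta sT t (Sg M theta sT t) + KK M t else Hg M theta sT t y.
Proof. by rewrite /Vg /sg /Hg /Sg /Vof; case: lev => [[]]. Qed.

Lemma VstarE x : (t < T M)%N ->
  Vstar M t x = inf [set KK M t * delta (y - x) + Hstar M t y | y in `[x, +oo[].
Proof.
move=> tT; rewrite /Vstar.
have -> : (T M - t = (T M - t.+1).+1)%N by lia.
by rewrite /= (_ : T M - (T M - t.+1).+1 = t)%N//; lia.
Qed.

Hypothesis tT : (t.+1 < T M)%N.

(** The fixpoints count periods backwards from [T M - 1]; this identity and the next expose one
    unfolding and recover the period index. *)
Let kE : (T M - 1 - t = (T M - 1 - t.+1).+1)%N. Proof. lia. Qed.
Let tE : (T M - 1 - (T M - 1 - t.+1).+1 = t)%N. Proof. lia. Qed.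

Lemma Hg_rec y : Hg M theta sT t y = Cf M t y +
  alpha M * cell_expectation R M theta t (fun n => Vg M theta sT t.+1 (y - zg theta n)).
Proof. by rewrite /Hg kE /= tE. Qed.

Lemma Sg_rec : Sg M theta sT t =
  gmax theta (fun z => It M theta sT t <= z <= SU M theta t /\
    forall z', ongrid theta z' -> It M theta sT t <= z' <= SU M theta t ->
      Hg M theta sT t z <= Hg M theta sT t z').
Proof. by rewrite /Sg /Hg kE /= tE. Qed.

Lemma sg_rec : sg M theta sT t =
  if KK M t == 0 then Sg M theta sT t
  else gmin theta (fun z => Ibar M theta sT t <= z <= Sg M theta sT t /\
    Hg M theta sT t z <= Hg M theta sT t (Sg M theta sT t) + KK M t).
Proof. by rewrite /sg /Sg /Hg kE /= tE. Qed.

Lemma Ibar_rec : Ibar M theta sT t = Ibar_step M theta t (Ibar M theta sT t.+1).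
Proof. by rewrite /Ibar kE /= tE. Qed.

Lemma psi_rec : psi M theta sT gamma t = psi_of M theta sT gamma t (phi M theta sT gamma t.+1).
Proof. by rewrite /psi tT. Qed.

Lemma psibar_rec :
  psibar M theta sT gamma t = psi_of M theta sT gamma t (phibar M theta sT gamma t.+1).
Proof. by rewrite /psibar tT. Qed.

Lemma phi_rec x y : phi M theta sT gamma t x y =
  if y < sg M theta sT t then 0
  else if y - x < sg M theta sT t then psi M theta sT gamma t (y - sg M theta sT t) y
  else psi M theta sT gamma t x y.
Proof. by rewrite psi_rec {1}/phi kE /= tE. Qed.

Lemma phibar_rec x y : phibar M theta sT gamma t x y =
  if y < sg M theta sT t then 0
  else if y - x < sg M theta sT t then psibar M theta sT gamma t (y - sg M theta sT t + theta) y
  else psibar M theta sT gamma t x y.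
Proof. by rewrite psibar_rec {1}/phibar kE /= tE. Qed.

Lemma omega_rec x : omega M theta sT gamma t x =
  psi M theta sT gamma t theta x - gamma t * theta +
  alpha M * cell_expectation R M theta t (fun n => ombar M theta sT gamma t.+1 (x - zg theta n)).
Proof. by rewrite /omega tT. Qed.

Lemma ombar_rec x : ombar M theta sT gamma t x =
  let eta := psibar M theta sT gamma t theta (SU M theta t) +
    omega M theta sT gamma t (SU M theta t) in
  if x <= SU M theta t then eta else Num.max eta (omega M theta sT gamma t x).
Proof. by rewrite /omega tT {1}/ombar kE /= tE. Qed.

End Recursion.

(** * Backward induction over the periods *)

Theorem theorem4p2 (R : realType) (M : model R) (theta sT : R) (gamma : nat -> R) :
  (2 <= T M)%N ->
  0 < alpha M <= 1 ->
  (forall t, (t < T M)%N -> 0 <= KK M t) ->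
  (* nonnegative demands with finite means *)
  (forall t, (t < T M)%N -> mu M t `]-oo, 0[ = 0%E) ->
  (forall t, (t < T M)%N -> (mu M t).-integrable setT (fun d : R => d%:E)) ->
  (* the expectations E[V*_{t+1}(y - D_t)] are finite *)
  (forall t y, (t < T M)%N ->
     (mu M t).-integrable setT (fun d : R => (Vstar M t.+1 (y - d))%:E)) ->
  (* standing assumptions (i), (ii) *)
  (forall t, (t < T M)%N -> convex_real (Cf M t) /\ coercive (Cf M t)) ->
  (forall t, (t.+2 <= T M)%N -> alpha M * KK M t.+1 <= KK M t) ->
  (* grid parameters *)
  0 < theta ->
  sT <= Cm M (T M - 1)%N ->
  Cf M (T M - 1)%N sT = Cf M (T M - 1)%N (Cm M (T M - 1)%N) + KK M (T M - 1)%N ->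
  (* Lipschitz constants *)
  (forall t, (t < T M)%N ->
     0 <= gamma t /\ forall x y, `|Cf M t x - Cf M t y| <= gamma t * `|x - y|) ->
  forall t x, (t < T M)%N ->
    Hg M theta sT t x - Hstar M t x <= omega M theta sT gamma t x /\
    Vg M theta sT t x - Vstar M t x <= ombar M theta sT gamma t x.
Proof.
move=> T2 /andP[al0 _] K0 dem0 _ iVs Cconv KK' theta0 sTm CsT lip.
pose spec t := level_spec R theta (KK M t) (Vg M theta sT t) (Vstar M t)
  (phi M theta sT gamma t) (phibar M theta sT gamma t) (ombar M theta sT gamma t)
  (sg M theta sT t) (Ibar M theta sT t).
(* The invariant at [t.+1] supplies the vanishing of [phi] below the reorder point, which [psi_ofE]
   requires. *)
have psiE t x y : (t.+1 < T M)%N -> spec t.+1 -> psi M theta sT gamma t x y = gamma t * x +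
    alpha M * cell_expectation R M theta t
      (fun n => phi M theta sT gamma t.+1 x (y - zg theta n)).
  move=> tT sp; rewrite psi_rec// psi_ofE//; first exact: dem0 (ltnW tT).
  exact: (ph_lt sp).
have psibarE t x y : (t.+1 < T M)%N -> spec t.+1 -> psibar M theta sT gamma t x y = gamma t * x +
    alpha M * cell_expectation R M theta t
      (fun n => phibar M theta sT gamma t.+1 x (y - zg theta n)).
  move=> tT sp; rewrite psibar_rec// psi_ofE//; first exact: dem0 (ltnW tT).
  exact: (phb_lt sp).
have last_spec : spec (T M - 1)%N.
  have tT : (T M - 1 < T M)%N by lia.
  have [cvx coe] := Cconv _ tT; have [g0 clip] := lip _ tT.
  rewrite /spec /phi /phibar /ombar /sg /Ibar subnn /=.
  apply: (level_spec_last R M theta sT (T M - 1)%N theta0 (K0 _ tT) cvx coe _ g0 clip sTm CsT) => //.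
    by move=> y; rewrite VgE /sg /Hg /Sg subnn.
  move=> x; rewrite VstarE//; congr inf; apply: eq_imagel => y _.
  rewrite /Hstar (_ : Vstar M (T M - 1).+1 = fun=> 0) ?Ex0 ?mulr0 ?addr0//.
  by rewrite /Vstar (_ : T M - (T M - 1).+1 = 0)%N//; lia.
have specP t : (t < T M)%N -> spec t.
  (* Induction on the number of periods remaining after [t]. *)
  move: {2}(T M - 1 - t)%N (erefl (T M - 1 - t)%N) => k; elim: k t => [|k IH] t tk tT.
    by have -> : t = (T M - 1)%N by lia.
  have tT' : (t.+1 < T M)%N by lia.
  have sp : spec t.+1 by apply: IH => //; lia.
  have [cvx coe] := Cconv _ tT; have [g0 clip] := lip _ tT.
  rewrite /spec Ibar_rec//.
  apply: (level_spec_step R M theta t theta0 (dem0 _ tT) al0 (K0 _ tT) cvx coe _ g0 clip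
    _ (KK' _ tT') _ _ _ _ _ _ _ sp (fun y => iVs t y tT) _ (Hstar M t) _ _ _
    (Hg_rec _ _ _ _ _ tT') (fun=> erefl) (fun x y => psiE t x y tT' sp)
    (fun x y => psibarE t x y tT' sp) (omega_rec _ _ _ _ _ _ tT') _ _
    (Sg_rec _ _ _ _ _ tT')).
  - by rewrite -Ibar_rec//; exact: sg_rec.
  - exact: VgE.
  - by move=> x; exact: VstarE.
  - exact: phi_rec.
  - exact: phibar_rec.
  - exact: ombar_rec.
move=> t x tT; split; last by have := V_gap (specP t tT) x; lra.
have [tT'|tT'] := ltnP t.+1 (T M).
  have sp := specP _ tT'.
  have [cvx coe] := Cconv _ tT; have [g0 clip] := lip _ tT.
  exact: (H_gap_same R M theta t theta0 (dem0 _ tT) al0 _ _ _ _ _ _ _ _ _ sp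
    (fun y => iVs t y tT) _ (Hstar M t) _ _ (Hg_rec _ _ _ _ _ tT') (fun=> erefl)
    (fun x y => psiE t x y tT' sp) (omega_rec _ _ _ _ _ _ tT')).
have -> : t = (T M - 1)%N by lia.
(* In the last period [Vstar] of the following period is zero, so [Hg] and [Hstar] both equal the
   cost function. *)
rewrite /omega ifF; last by lia.
rewrite /Hg subnn /Hstar (_ : Vstar M (T M - 1).+1 = fun=> 0) ?Ex0 /=; first by lra.
by rewrite /Vstar (_ : T M - (T M - 1).+1 = 0)%N//; lia.
Qed.
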